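(* Let $q,p\colon\mathbb{R}\to\mathbb{R}$ be BPUC functions, assume that the equation $$x'=-x^2+q(t)\,x+p(t)\qquad(\ast)$$ has bounded solutions, and let $a$ and $r$ be its maximal and minimal bounded solutions, respectively (see context). Then the following assertions are equivalent: (a) The solutions $a$ and $r$ are uniformly separated. (b) The solutions $a$ and $r$ are hyperbolic, with $a$ attractive and $r$ repulsive. (c) The equation $(\ast)$ has two different hyperbolic solutions. In this case: (i) Let $(k_a,\beta_a)$ and $(k_r,\beta_r)$ be dichotomy constant pairs for the hyperbolic solutions $a$ and $r$, respectively, and choose any $\bar\beta_a\in(0,\beta_a)$ and any $\bar\beta_r\in(0,\beta_r)$. Then, given $\varepsilon>0$, there exist $k_{a,\varepsilon}\ge 1$ and $k_{r,\varepsilon}\ge 1$ (depending also on the choice of $\bar\beta_a$ and of $\bar\beta_r$, respectively) such that $$|a(t)-x(t,s,x_0)|\le k_{a,\varepsilon}\,e^{-\bar\beta_a(t-s)}|a(s)-x_0|\quad\text{if }x_0\ge r(s)+\varepsilon\text{ and }t\ge s,$$ $$|r(t)-x(t,s,x_0)|\le k_{r,\varepsilon}\,e^{\bar\beta_r(t-s)}|r(s)-x_0|\quad\text{if }x_0\le a(s)-\varepsilon\text{ and }t\le s.$$ In addition, $$|a(t)-x(t,s,x_0)|\le k_a\,e^{-\beta_a(t-s)}|a(s)-x_0|\quad\text{if }x_0\ge a(s)\text{ and }t\ge s,$$ $$|r(t)-x(t,s,x_0)|\le k_r\,e^{\beta_r(t-s)}|r(s)-x_0|\quad\text{if }x_0\le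 r(s)\text{ and }t\le s.$$ (ii) The equation $(\ast)$ does not have more hyperbolic solutions, and $a$ and $r$ are the only bounded solutions of $(\ast)$ which are uniformly separated.
   Context: BPUC functions: a set $\Delta=\{a_j\mid j\in\mathbb{Z}\}\subset\mathbb{R}$ is disperse if $\inf_{j\in\mathbb{Z}}(a_{j+1}-a_j)>0$. $BPUC_\Delta(\mathbb{R},\mathbb{R})$ is the set of bounded right-continuous functions $q\colon\mathbb{R}\to\mathbb{R}$ such that for all $\varepsilon>0$ there is $\delta>0$ such that, if $t_1,t_2\in(a_j,a_{j+1})$ for some $j\in\mathbb{Z}$ and $|t_2-t_1|<\delta$, then $|q(t_2)-q(t_1)|<\varepsilon$. A function $q$ is BPUC (bounded piecewise uniformly continuous) if $q=q_1+\cdots+q_n$ with $q_i\in BPUC_{\Delta_i}(\mathbb{R},\mathbb{R})$ for finitely many disperse sets $\Delta_1,\dots,\Delta_n$. Solutions are in the Carathéodory sense: absolutely continuous on compact intervals and satisfying the equation at Lebesgue-a.e. $t$. $t\mapsto x(t,s,x_0)$ is the unique maximal solution of $(\ast)$ with $x(s,s,x_0)=x_0$. ''Bounded solution'' means globally defined and bounded on $\mathbb{R}$. Functions $a$ and $r$: if $(\ast)$ has bounded solutions, then there are globally defined bounded solutions $r\le a$ of $(\ast)$ such that $x(\cdot,s,x_0)$ is a bounded solution if and only if $r(s)\le x_0\le a(s)$. Two globally defined solutions $x_1\le x_2$ are uniformly separated if $\inf_{t\in\mathbb{R}}(x_2(t)-x_1(t))>0$. A bounded solution $\tilde b\colon\mathbb{R}\to\mathbb{R}$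 of $(\ast)$ is hyperbolic if there exist $k_b\ge1$ and $\beta_b>0$ such that either $\exp\int_s^t(-2\tilde b(l)+q(l))\,dl\le k_b e^{-\beta_b(t-s)}$ whenever $t\ge s$ (then $\tilde b$ is attractive), or $\exp\int_s^t(-2\tilde b(l)+q(l))\,dl\le k_b e^{\beta_b(t-s)}$ whenever $t\le s$ (then $\tilde b$ is repulsive). Such $(k_b,\beta_b)$ is called a dichotomy constant pair for $\tilde b$. *)

(* Defs.v *)
From mathcomp Require Import all_boot all_order all_algebra.
From mathcomp Require Import all_classical all_reals all_analysis.

Set Implicit Arguments.
Unset Strict Implicit.
Unset Printing Implicit Defensive.

Import Order.TTheory GRing.Theory Num.Theory.
Import numFieldNormedType.Exports.

Local Open Scope classical_set_scope.
Local Open Scope ring_scope.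

(* A disperse set is given by its enumeration by the integers. In the library
   [inf A = 0] when [A] is not bounded below, so [0 < inf A] does imply that
   [A] is bounded below by a positive constant. *)
Definition disperse {R : realType} (d : int -> R) : Prop :=
  0 < inf (range (fun j : int => d (j + 1) - d j)).

Definition BPUC_on {R : realType} (d : int -> R) (q : R -> R) : Prop :=
  [/\ bounded_fun q,
      right_continuous q &
      forall eps : R, 0 < eps -> exists2 delta : R, 0 < delta &
        forall (j : int) (t1 t2 : R),
          d j < t1 < d (j + 1) -> d j < t2 < d (j + 1) ->
          `|t2 - t1| < delta -> `|q t2 - q t1| < eps].

Definition BPUC {R : realType} (q : R -> R) : Prop :=
  exists (n : nat) (d : 'I_n -> int -> R) (f : 'I_n -> R -> R),
    (forall i, disperse (d i) /\ BPUC_on (d i) (f i)) /\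
    (forall t, q t = \sum_(i < n) f i t).

Definition abs_continuous {R : realType} (c d : R) (x : R -> R) : Prop :=
  forall eps : R, 0 < eps -> exists2 delta : R, 0 < delta &
    forall (n : nat) (u v : 'I_n -> R),
      (forall i, [/\ c <= u i, u i < v i & v i <= d]) ->
      trivIset [set: 'I_n] (fun i => `]u i, v i[%classic) ->
      \sum_(i < n) (v i - u i) < delta ->
      \sum_(i < n) `|x (v i) - x (u i)| < eps.

(* Only the values of [x] on [I] matter. *)
Definition solution_on {R : realType} (q p : R -> R) (I : set R) (x : R -> R)
    : Prop :=
  [/\ open I, is_interval I,
      forall c d : R, c <= d -> `[c, d]%classic `<=` I -> abs_continuous c d x &
      {ae @lebesgue_measure R, forall t : R, I t ->
        is_derive t 1 x (- x t ^+ 2 + q t * x t + p t)}].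

Definition maximal_solution {R : realType} (q p : R -> R) (s x0 : R)
    (I : set R) (x : R -> R) : Prop :=
  [/\ solution_on q p I x, I s, x s = x0 &
      forall (J : set R) (y : R -> R), solution_on q p J y ->
        I `<=` J -> (forall t, I t -> y t = x t) -> J `<=` I].

(* The maximal solution with [x(s) = x0], as its domain together with a
   function whose values outside that domain are irrelevant. The default, used
   only if there is no maximal solution, has empty domain. *)
Definition flow_pair {R : realType} (q p : R -> R) (s x0 : R)
    : set R * (R -> R) :=
  xget (set0, fun=> 0)
       [set Ix | maximal_solution q p s x0 Ix.1 Ix.2].

Definition flow_dom {R : realType} (q p : R -> R) (s x0 : R) : set R :=
  (flow_pair q p s x0).1.

(* [flow q p t s x0] is x(t,s,x0); meaningful for [t] in [flow_dom q p s x0]. *)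
Definition flow {R : realType} (q p : R -> R) (t s x0 : R) : R :=
  (flow_pair q p s x0).2 t.

Definition bounded_solution {R : realType} (q p : R -> R) (b : R -> R) : Prop :=
  solution_on q p setT b /\ bounded_fun b.

Definition extremal_bounded_solutions {R : realType} (q p r a : R -> R)
    : Prop :=
  [/\ bounded_solution q p r, bounded_solution q p a,
      forall t, r t <= a t &
      forall s x0 : R,
        (flow_dom q p s x0 = setT /\
         bounded_solution q p (fun t => flow q p t s x0)) <->
        r s <= x0 <= a s].

Definition uniformly_separated {R : realType} (x1 x2 : R -> R) : Prop :=
  (forall t, x1 t <= x2 t) /\ 0 < inf (range (fun t => x2 t - x1 t)).

Definition oriented_integral {R : realType} (f : R -> R) (s t : R) : R :=
  if s <= t then \int[@lebesgue_measure R]_(l in `[s, t]) f l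
  else - \int[@lebesgue_measure R]_(l in `[t, s]) f l.

Definition attractive_bound {R : realType} (q b : R -> R) (k beta : R) : Prop :=
  forall s t : R, s <= t ->
    expR (oriented_integral (fun l => - 2 * b l + q l) s t) <=
      k * expR (- beta * (t - s)).

Definition repulsive_bound {R : realType} (q b : R -> R) (k beta : R) : Prop :=
  forall s t : R, t <= s ->
    expR (oriented_integral (fun l => - 2 * b l + q l) s t) <=
      k * expR (beta * (t - s)).

Definition dichotomy_pair {R : realType} (q b : R -> R) (k beta : R) : Prop :=
  [/\ 1 <= k, 0 < beta &
      attractive_bound q b k beta \/ repulsive_bound q b k beta].

Definition hyperbolic {R : realType} (q p b : R -> R) : Prop :=
  bounded_solution q p b /\ exists k beta : R, dichotomy_pair q b k beta.

Definition attractive {R : realType} (q b : R -> R) : Prop :=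
  exists k beta : R, [/\ 1 <= k, 0 < beta & attractive_bound q b k beta].

Definition repulsive {R : realType} (q b : R -> R) : Prop :=
  exists k beta : R, [/\ 1 <= k, 0 < beta & repulsive_bound q b k beta].

(* Main.v *)
Require Import Defs.
From mathcomp Require Import all_boot all_order all_algebra.
From mathcomp Require Import all_classical all_reals all_analysis measurable_realfun.
From mathcomp Require Import lra ring.

Set Implicit Arguments.
Unset Strict Implicit.
Unset Printing Implicit Defensive.

Import Order.TTheory GRing.Theory Num.Theory.
Import numFieldNormedType.Exports.

Local Open Scope classical_set_scope.
Local Open Scope ring_scope.

(** The equation is the Riccati equation x' = - x^2 + q x + p, and everything
    follows from two explicit formulas relative to a known global solution b.
    Write G_b(s,t) for the exponential of the integral of q - 2 b from s to t;
    bounds on G_b are what hyperbolicity of b means.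

    First formula. The substitution x = b + w gives w' = (q - 2 b) w - w^2,
    hence the solution with x(s) = x0, where y = x0 - b(s), is
    b(t) + y G_b(s,t) / D(t), with D(t) = 1 + y times the integral of G_b(s,l)
    over l from s to t, and it lives exactly on the interval where D > 0
    ([flow_pairP]). This gives existence, uniqueness and the domain of the flow
    at once, and reduces the estimates of (i) to lower bounds for D. On the side
    of b away from the other extremal solution D >= 1 ([denom_ge1]). On the
    other side D is affine in y and positive for the deviation of the other
    extremal solution, so it is bounded below when x0 keeps the distance eps
    from that solution ([denom_ge_between]).

    Second formula. For global solutions b and c the difference c - b has
    logarithmic derivative q - b - c, so that G_b(s,t) (c - b)(s) equals
    (c - b)(t) times the exponential of the integral of c - b from s to t
    ([growth_difference]); for G_c that integral changes sign. If c - b is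
    bounded and at least delta > 0, then G_c decays forwards and G_b decays
    backwards with exponent delta, which is (a) => (b). (b) => (c) holds because
    no solution is both attractive and repulsive. For (c) => (a), if b < c are
    both hyperbolic, the formula forces b to be repulsive and c to be attractive
    ([ordered_dichotomy]), and playing the two dichotomies against each other
    bounds c - b from below ([dichotomies_separated]); r and a enclose b and c.
    The same ordering argument shows (ii): a third hyperbolic solution between r
    and a would be repulsive because of a and attractive because of r.

    Solutions are only absolutely continuous, so these computations rest on the
    theorem that an absolutely continuous function with an almost everywhere
    nonnegative derivative is nondecreasing
    ([abs_continuous_ae_nondecreasing]), and on Lebesgue's differentiation
    theorem for primitives of the bounded measurable function q - 2 b. *)

(** * Absolutely continuous functions *)

Lemma abs_continuous_uniform {R : realType} (c d : R) (x : R -> R) :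
  abs_continuous c d x -> forall eps : R, 0 < eps -> exists2 delta : R,
    0 < delta & forall u v, c <= u <= d -> c <= v <= d -> `|v - u| < delta ->
      `|x v - x u| < eps.
Proof.
move=> acx eps eps0; have [delta delta0 H] := acx _ eps0.
exists delta => //.
have lt_case u v : c <= u <= d -> c <= v <= d -> u < v -> v - u < delta ->
    `|x v - x u| < eps.
  move=> /andP[cu _] /andP[_ vd] uv uvd.
  have := H 1%N (fun=> u) (fun=> v); rewrite !big_ord1; apply => //.
  by move=> i j _ _ _; rewrite !ord1.
move=> u v cu cv; have [uv|vu|->] := ltgtP u v.
- by rewrite gtr0_norm ?subr_gt0//; exact: lt_case.
- by rewrite distrC (distrC (x v)) gtr0_norm ?subr_gt0//; exact: lt_case.
- by rewrite !subrr !normr0.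
Qed.

(** All closure properties of absolute continuity needed here are instances:
    the increments of the new function are dominated by those of two functions
    already known to be absolutely continuous. *)
Lemma abs_continuous_dominated {R : realType} (c d L : R) (x y z : R -> R) :
  abs_continuous c d x -> abs_continuous c d y ->
  (forall u v, c <= u -> u <= v -> v <= d ->
    `|z v - z u| <= L * (`|x v - x u| + `|y v - y u|)) ->
  abs_continuous c d z.
Proof.
move=> acx acy zxy eps eps0.
have L0 : 0 < `|L| + 1 by rewrite ltr_wpDl.
have e0 : 0 < eps / (2 * (`|L| + 1)) by rewrite divr_gt0 ?mulr_gt0.
have [d1 d10 H1] := acx _ e0; have [d2 d20 H2] := acy _ e0.
exists (Num.min d1 d2); first by rewrite lt_min d10.
move=> n u v uv tI; rewrite lt_min => /andP[s1 s2].
have {H1} := H1 _ _ _ uv tI s1; have {H2} := H2 _ _ _ uv tI s2.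
set Sy := \sum_(i < n) _; set Sx := \sum_(i < n) _ => hy hx.
apply: (@le_lt_trans _ _ ((`|L| + 1) * (Sx + Sy))).
  rewrite -big_split/= mulr_sumr; apply: ler_sum => i _.
  have [cu uvi vd] := uv i; apply: (le_trans (zxy _ _ cu (ltW uvi) vd)).
  apply: ler_wpM2r; first by rewrite addr_ge0.
  by rewrite (le_trans (ler_norm L))// lerDl.
have -> : eps = (`|L| + 1) * (eps / (2 * (`|L| + 1)) + eps / (2 * (`|L| + 1))).
  by field; rewrite gt_eqF.
by rewrite ltr_pM2l// ltrD.
Qed.

Lemma abs_continuous_id {R : realType} (c d : R) : abs_continuous c d id.
Proof.
move=> eps eps0; exists eps => // n u v uv _.
by under eq_bigr => i _ do [have [_ /ltW h _] := uv i;
  rewrite -(ger0_norm (_ : 0 <= v i - u i)) ?subr_ge0//].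
Qed.

Lemma abs_continuous_lipschitz {R : realType} (c d L : R) (z : R -> R) :
  (forall u v, c <= u -> u <= v -> v <= d -> `|z v - z u| <= L * (v - u)) ->
  abs_continuous c d z.
Proof.
move=> zL; apply: (@abs_continuous_dominated _ c d (L / 2) id id);
  [exact: abs_continuous_id..|].
move=> u v cu uv vd; apply: (le_trans (zL u v cu uv vd)).
by rewrite ger0_norm ?subr_ge0//; lra.
Qed.

Lemma abs_continuous_bounded {R : realType} (c d : R) (x : R -> R) :
  abs_continuous c d x -> exists M, forall t, c <= t <= d -> `|x t| <= M.
Proof.
have [dc _|cd acx] := ltP d c.
  by exists 0 => t /andP[ct td]; have := le_lt_trans (le_trans ct td) dc;
     rewrite ltxx.
(* clamping to [c, d] extends x to a function continuous on the whole line, to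
   which the extreme value theorem applies *)
pose k t : R := Num.min d (Num.max c t).
have kcd t : c <= k t <= d.
  by rewrite /k le_min cd le_max lexx/= ge_min lexx.
have k1 u v : `|k v - k u| <= `|v - u|.
  have := ler_norm (v - u); have := ler_norm (u - v).
  rewrite (distrC u v) /k => ? ?; rewrite ler_norml.
  case: (leP d (Num.max c u)); case: (leP d (Num.max c v));
    by case: (leP c u) => ?; case: (leP c v) => ? ? ?; apply/andP; split; lra.
have cx : continuous (fun t => `|x (k t)|).
  move=> t; apply: (@cvg_norm R R) => //.
  apply/cvgrPdist_lt => e e0; have [delta delta0 H] :=
    abs_continuous_uniform acx e0.
  near=> u; apply: H => //; apply: (le_lt_trans (k1 _ _)).
  near: u; exact: cvgr_dist_lt.
have [|m _ Hm] := @EVT_max R (fun t => `|x (k t)|) c d cd.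
  exact: continuous_subspaceT.
exists (`|x (k m)|) => t tcd.
have <- : k t = t.
  by move: tcd => /andP[ct td]; rewrite /k max_r// min_r.
have : k t \in `[c, d] by rewrite in_itv/= kcd.
move=> /Hm; suff -> : k (k t) = k t by [].
by have /andP[ct td] := kcd t; rewrite {1}/k max_r// min_r.
Unshelve. all: by end_near. Qed.

Lemma abs_continuous_continuous {R : realType} (x : R -> R) :
  (forall c d, c <= d -> abs_continuous c d x) -> continuous x.
Proof.
move=> acx t; apply/cvgrPdist_lt => e e0.
have t11 : t - 1 <= t + 1 by lra.
have [delta delta0 H] := abs_continuous_uniform (acx _ _ t11) e0.
near=> u.
have ut : `|t - u| < Num.min 1 delta.
  by near: u; apply: cvgr_dist_lt => //; rewrite lt_min ltr01.
move: ut; rewrite lt_min => /andP[u1 ud]; apply: H => //.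
  by move: u1; rewrite ltr_norml => /andP[h1 h2]; apply/andP; split; lra.
by apply/andP; split; lra.
Unshelve. all: by end_near. Qed.

(** * Monotonicity from the sign of an almost everywhere derivative *)

(** Cousin's covering principle. The supremum of the points that can be reached
    from c is itself reached, and it could be passed if it were less than d. *)
Lemma cousin {R : realType} (P : R -> R -> Prop) (c d : R) : c <= d ->
  (forall u v w, u <= v -> v <= w -> P u v -> P v w -> P u w) ->
  (forall t, c <= t <= d -> exists2 e, 0 < e & forall u v, c <= u -> v <= d ->
     t - e < u -> u <= t -> t <= v -> v < t + e -> P u v) ->
  P c d.
Proof.
move=> cd Padd Ploc.
pose S := [set t | c <= t <= d /\ P c t].
have Sc : S c.
  split; first by rewrite lexx.
  have [|e e0 He] := Ploc c; first by rewrite lexx.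
  by apply: He => //; lra.
have Sd : ubound S d by move=> t [/andP[]].
have hS : has_sup S by split; [exists c|exists d].
pose m := sup S.
have cm : c <= m by apply: ub_le_sup => //; exists d.
have md : m <= d by apply: ge_sup => //; exists c.
have [|e e0 He] := Ploc m; first by rewrite cm.
have [t [tcd Pct] mt] := sup_adherent e0 hS.
have tm : t <= m by apply: ub_le_sup => //; exists d.
have [/andP[ct td]] := tcd.
have [m_d|dm] := ltP m d; last first.
  have -> : d = m by apply/eqP; rewrite eq_le dm md.
  by apply: (Padd _ t) => //; apply: He => //; lra.
pose v := Num.min d (m + e / 2).
have mv : m < v by rewrite lt_min m_d; lra.
have vd : v <= d by rewrite ge_min lexx.
have ve : v < m + e by rewrite gt_min; apply/orP; right; lra.
have : S v.
  split; first by apply/andP; split => //; lra.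
  apply: (Padd _ t) => //; first lra.
  by apply: He => //; lra.
move=> /(ub_le_sup (ex_intro _ d Sd)); rewrite -/m; lra.
Qed.

(** The base point t may lie anywhere in [u, v]: this is the form in which a
    derivative controls the intervals of a partition tagged at t. *)
Lemma derive_increment_ge {R : realType} (x : R -> R) (t g eps : R) :
  is_derive t 1 x g -> 0 <= g -> 0 < eps ->
  exists2 e, 0 < e & forall u v, t - e < u -> u <= t -> t <= v -> v < t + e ->
    - eps * (v - u) <= x v - x u.
Proof.
move=> dx g0 eps0.
have /cvgrPdist_lt/(_ _ eps0) : h^-1 *: (x (h *: 1 + t) - x t) @[h --> 0^'] --> g.
  by have [dtx <-] := dx; exact: dtx.
rewrite near_withinE => /nbhs_ballP[e /= e0 He].
have Hq h : `|h| < e -> h != 0 -> - eps < h^-1 * (x (h + t) - x t).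
  move=> he h0; have := He h; rewrite /ball/= sub0r normrN => /(_ he h0).
  rewrite /GRing.scale/= mulr1 ltr_norml => /andP[_]; lra.
have ge_right v : t <= v -> v < t + e -> - eps * (v - t) <= x v - x t.
  rewrite le_eqVlt => /predU1P[<- _|tv ve]; first by rewrite !subrr mulr0.
  have vt : 0 < v - t by rewrite subr_gt0.
  have := Hq (v - t); rewrite gtr0_norm// subrK gt_eqF// => /(_ _ isT) H.
  have {}H := H ltac:(lra).
  by rewrite -(ler_pM2l (_ : 0 < (v - t)^-1)) ?invr_gt0// mulrCA mulVf ?gt_eqF//
    mulr1 ltW.
have ge_left u : t - e < u -> u <= t -> - eps * (t - u) <= x t - x u.
  move=> eu; rewrite le_eqVlt => /predU1P[->|ut]; first by rewrite !subrr mulr0.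
  have tu : u - t < 0 by rewrite subr_lt0.
  have := Hq (u - t); rewrite ltr0_norm// subrK lt_eqF// => /(_ _ isT) H.
  have {}H := H ltac:(lra).
  have tu' : 0 < t - u by rewrite subr_gt0.
  rewrite -(ler_pM2l (_ : 0 < (t - u)^-1)) ?invr_gt0// mulrCA mulVf ?gt_eqF//.
  by rewrite mulr1 -(opprB u t) -(opprB (x u)) invrN mulrNN ltW.
exists e => // u v eu ut tv ve.
by have := ge_right v tv ve; have := ge_left u eu ut; lra.
Qed.

(** Lists from left to right, rather than families indexed by ordinals, so that
    gluing two chains at a common endpoint is concatenation. The last condition
    remembers that the intervals lie in U: it is additive under gluing and
    bounds the total length by the measure of U. *)
Definition interval_chain {R : realType} (U : set R) (u v : R)
    (s : seq (R * R)) : Prop :=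
  [/\ all (fun p => (u <= p.1) && (p.1 < p.2) && (p.2 <= v)) s,
      pairwise (fun p p' : R * R => p.2 <= p'.1) s &
      ((\sum_(p <- s) (p.2 - p.1))%:E <=
        (@lebesgue_measure R) (U `&` `[u, v[))%E].

Lemma interval_chain_cat {R : realType} (U : set R) (u v w : R) s1 s2 :
  measurable U -> u <= v -> v <= w ->
  interval_chain U u v s1 -> interval_chain U v w s2 ->
  interval_chain U u w (s1 ++ s2).
Proof.
move=> mU uv vw [/allP/= a1 p1 l1] [/allP/= a2 p2 l2]; split.
- apply/allP => p; rewrite mem_cat => /orP[/a1|/a2] /andP[/andP[h1 h2] h3].
    by rewrite h1 h2 (le_trans h3).
  by rewrite h2 h3 (le_trans uv h1).
- rewrite pairwise_cat p1 p2 !andbT; apply/allrelP => p p'.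
  by move=> /a1/andP[_ h1] /a2/andP[/andP[h2 _] _]; exact: le_trans h2.
- rewrite big_cat/= EFinD.
  have -> : U `&` `[u, w[ = (U `&` `[u, v[) `|` (U `&` `[v, w[).
    rewrite -setIUr; congr (_ `&` _); apply/seteqP; split => t /=;
      rewrite !in_itv/=.
      by move=> /andP[-> ->]; case: (ltP t v) => _; [left|right].
    by move=> [] /andP[h1 h2]; apply/andP; split => //;
      [exact: lt_le_trans vw|exact: le_trans h1].
  rewrite measureU/=; [exact: leeD|exact: measurableI|exact: measurableI|].
  apply/seteqP; split => // t /=; rewrite !in_itv/=.
  by move=> [[_ /andP[_ tv]] [_ /andP[/le_lt_trans/(_ tv)]]]; rewrite ltxx.
Qed.

Lemma abs_continuous_chain {R : realType} (c d eps : R) (x : R -> R) :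
  abs_continuous c d x -> 0 < eps -> exists2 delta, 0 < delta &
  forall U s, interval_chain U c d s ->
    ((@lebesgue_measure R) U < delta%:E)%E -> measurable U ->
    \sum_(p <- s) `|x p.2 - x p.1| < eps.
Proof.
move=> acx eps0; have [delta delta0 H] := acx _ eps0; exists delta => //.
move=> U s [/allP/= a1 /(pairwiseP (0, 0)) p1 l1] mUd mU.
have := H (size s) (fun i => (nth (0, 0) s i).1) (fun i => (nth (0, 0) s i).2).
rewrite !(big_nth (0, 0)) !big_mkord; apply.
- by move=> i; have /andP[/andP[]] := a1 _ (mem_nth (0, 0) (ltn_ord i)).
- move=> i j _ _ [t /= []]; rewrite !in_itv/= => /andP[h1 h2] /andP[h3 h4].
  apply: val_inj; case: (ltngtP i j) => // ij.
  + have := p1 _ _ (ltn_ord i) (ltn_ord j) ij.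
    by move=> /(lt_le_trans h2)/lt_trans/(_ h3); rewrite ltxx.
  + have := p1 _ _ (ltn_ord j) (ltn_ord i) ij.
    by move=> /(lt_le_trans h4)/lt_trans/(_ h1); rewrite ltxx.
- rewrite -lte_fin; apply: le_lt_trans mUd.
  move: l1; rewrite (big_nth (0, 0)) big_mkord => /le_trans; apply.
  apply: le_measure; rewrite ?inE//.
  exact: measurableI.
Qed.

Lemma negligible_open_cover {R : realType} (N : set R) (delta : R) :
  (@lebesgue_measure R).-negligible N -> 0 < delta ->
  exists U, [/\ open U, N `<=` U & ((@lebesgue_measure R) U < delta%:E)%E].
Proof.
move=> [A [mA A0 NA]] delta0.
have [|U [oU AU mUA]] := @lebesgue_regularity_outer R A delta mA _ delta0.
  by move: A0 => /= A0; rewrite [X in (X < _)%E]A0.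
exists U; split => //; first exact: subset_trans AU.
rewrite (_ : lebesgue_measure U = lebesgue_measure (U `\` A))//.
have mU : measurable U by exact: open_measurable.
rewrite -[in LHS](setDUK AU) measureU//=; last 2 first.
- exact: measurableD.
- by rewrite setDE setICA setICr setI0.
by rewrite A0 add0e.
Qed.

(** Given eps, the exceptional null set is covered by an open set so small that
    chains inside it contribute at most eps to the variation. Around all other
    points the derivative controls the increments, and the covering principle
    glues the two kinds of intervals. *)
Theorem abs_continuous_ae_nondecreasing {R : realType} (c d : R)
    (x g : R -> R) : c <= d -> abs_continuous c d x ->
  {ae @lebesgue_measure R, forall t, c < t < d -> is_derive t 1 x (g t)} ->
  (forall t, c < t < d -> 0 <= g t) -> x c <= x d.
Proof.
move=> cd acx dx g0; apply/ler_addgt0Pr => e e0.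
(* chosen so that eps (d - c) from the good points and eps from the chain add
   up to e *)
pose eps := e / (d - c + 1).
have dc0 : 0 < d - c + 1 by lra.
have eps0 : 0 < eps by rewrite divr_gt0.
have [delta delta0 Hac] := abs_continuous_chain acx eps0.
(* the endpoints carry no information on the derivative; adding them to the
   exceptional set costs nothing *)
pose N := ~` [set t | c < t < d -> is_derive t 1 x (g t)] `|`
  ([set c] `|` [set d]).
have N0 : (@lebesgue_measure R).-negligible N.
  apply: negligibleU => //; apply: negligibleU;
  apply/negligibleP => //; exact: lebesgue_measure_set1.
have [U [oU NU mUd]] := negligible_open_cover N0 delta0.
have mU : measurable U by exact: open_measurable.
(* on a chain the increments of x are unrestricted; elsewhere x decreases at
   most at rate eps *)
pose P u v := exists2 s, interval_chain U u v s &
  x u <= x v + eps * (v - u) + \sum_(p <- s) `|x p.2 - x p.1|.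
have [||s ch] := @cousin R P c d cd.
- move=> u v w uv vw [s1 ch1 le1] [s2 ch2 le2]; exists (s1 ++ s2).
    exact: interval_chain_cat ch1 ch2.
  by rewrite big_cat/=; lra.
- move=> t /andP[ct td]; have [Nt|Nt] := pselect (N t).
  + have /nbhs_ballP[r /= r0 Ur] : nbhs t U.
      by apply: open_nbhs_nbhs; split => //; exact: NU.
    exists r => // u v cu vd tu ut tv vt.
    have Uuv w : u <= w <= v -> U w.
      move=> /andP[uw wv]; apply: Ur; rewrite /ball/= ltr_norml.
      by apply/andP; split; lra.
    have [uv|vu] := ltP u v; last first.
      have <- : u = v by apply/eqP; rewrite eq_le vu (le_trans ut).
      exists [::]; last by rewrite big_nil; lra.
      by split => //; rewrite big_nil measure_ge0.
    exists [:: (u, v)].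
      split => /=; first by rewrite !lexx uv.
        by [].
      rewrite big_cons big_nil addr0 setIidr; last first.
        by move=> w /=; rewrite in_itv/= => /andP[uw /ltW wv]; apply: Uuv; lra.
      by rewrite lebesgue_measure_itv/= lte_fin uv -EFinB.
    rewrite big_cons big_nil/= addr0.
    have := ler_norm (x u - x v); rewrite distrC.
    have : 0 <= eps * (v - u) by rewrite mulr_ge0 ?subr_ge0 ?ltW.
    lra.
  + have tcd : c < t < d.
      rewrite !lt_neqAle ct td !andbT; apply/andP; split; apply/eqP => tE;
        apply: Nt; right; [by left|by right].
    have dxt : is_derive t 1 x (g t).
      by apply: contrapT => nd; apply: Nt; left => /(_ tcd).
    have [r r0 Hr] := derive_increment_ge dxt (g0 _ tcd) eps0.
    exists r => // u v cu vd tu ut tv vt; exists [::].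
      by split => //; rewrite big_nil measure_ge0.
    by rewrite big_nil; have := Hr _ _ tu ut tv vt; lra.
have {Hac}Hs := Hac _ _ ch mUd mU => le_x; apply: (le_trans le_x).
have -> : e = eps * (d - c) + eps by rewrite /eps; field; rewrite gt_eqF.
lra.
Qed.

(** * Calculus of absolutely continuous functions *)

Lemma ae_filterS {R : realType} (P Q : set R) :
  (forall t, P t -> Q t) -> {ae @lebesgue_measure R, forall t, P t} ->
  {ae @lebesgue_measure R, forall t, Q t}.
Proof.
by apply: filterS; exact: (ae_filter_ringOfSetsType (@lebesgue_measure R)).
Qed.

Lemma ae_filterS2 {R : realType} (P Q S : set R) :
  (forall t, P t -> Q t -> S t) -> {ae @lebesgue_measure R, forall t, P t} ->
  {ae @lebesgue_measure R, forall t, Q t} ->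
  {ae @lebesgue_measure R, forall t, S t}.
Proof.
by apply: filterS2; exact: (ae_filter_ringOfSetsType (@lebesgue_measure R)).
Qed.

(** The regularity required of Caratheodory solutions of x' = g, separated from
    any particular equation. *)
Definition ac_deriv {R : realType} (I : set R) (x g : R -> R) : Prop :=
  (forall c d, c <= d -> `[c, d]%classic `<=` I -> abs_continuous c d x) /\
  {ae @lebesgue_measure R, forall t, I t -> is_derive t 1 x (g t)}.

Lemma ac_deriv_eq {R : realType} (I : set R) (x g h : R -> R) :
  (forall t, I t -> g t = h t) -> ac_deriv I x g -> ac_deriv I x h.
Proof.
move=> gh [acx dx]; split => //; apply: ae_filterS dx => t dx It.
by rewrite -gh//; exact: dx.
Qed.

Lemma ac_deriv_sub {R : realType} (I J : set R) (x g : R -> R) :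
  J `<=` I -> ac_deriv I x g -> ac_deriv J x g.
Proof.
move=> JI [acx dx]; split.
  by move=> c d cd /subset_trans/(_ JI); exact: acx.
by apply: ae_filterS dx => t dx /JI; exact: dx.
Qed.

Lemma ac_deriv_cst {R : realType} (I : set R) (k : R) :
  ac_deriv I (fun=> k) (fun=> 0).
Proof.
split; last by apply: aeW => t _; exact: is_derive_cst.
move=> c d _ _; apply: (@abs_continuous_lipschitz _ _ _ 0) => u v _ _ _.
by rewrite subrr normr0 mul0r.
Qed.

Lemma ac_deriv_id {R : realType} (I : set R) : ac_deriv I id (fun=> 1).
Proof.
split; last by apply: aeW => t _; exact: is_derive_id.
by move=> c d _ _; exact: abs_continuous_id.
Qed.

Lemma ac_derivD {R : realType} (I : set R) (x y g h : R -> R) :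
  ac_deriv I x g -> ac_deriv I y h ->
  ac_deriv I (fun t => x t + y t) (fun t => g t + h t).
Proof.
move=> [acx dx] [acy dy]; split.
  move=> c d cd cdI; apply: (abs_continuous_dominated (L := 1)
    (acx _ _ cd cdI) (acy _ _ cd cdI)) => u v _ _ _.
  by rewrite mul1r opprD addrACA; exact: ler_normD.
apply: ae_filterS2 dx dy => t dx dy It; exact: is_deriveD (dx It) (dy It).
Qed.

Lemma ac_derivM {R : realType} (I : set R) (x y g h : R -> R) :
  ac_deriv I x g -> ac_deriv I y h ->
  ac_deriv I (fun t => x t * y t) (fun t => g t * y t + x t * h t).
Proof.
move=> [acx dx] [acy dy]; split.
  move=> c d cd cdI; have ax := acx _ _ cd cdI; have ay := acy _ _ cd cdI.
  have [M HM] := abs_continuous_bounded ax.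
  have [N HN] := abs_continuous_bounded ay.
  apply: (abs_continuous_dominated (L := M + N) ax ay) => u v cu uv vd.
  have Mu : `|x u| <= M by apply: HM; lra.
  have Nv : `|y v| <= N by apply: HN; lra.
  have -> : x v * y v - x u * y u = (x v - x u) * y v + x u * (y v - y u).
    by ring.
  apply: (le_trans (ler_normD _ _)); rewrite !normrM.
  have h1 := ler_wpM2l (normr_ge0 (x v - x u)) Nv.
  have h2 := ler_wpM2r (normr_ge0 (y v - y u)) Mu.
  have h3 := mulr_ge0 (normr_ge0 (x v - x u)) (le_trans (normr_ge0 _) Mu).
  have h4 := mulr_ge0 (normr_ge0 (y v - y u)) (le_trans (normr_ge0 _) Nv).
  lra.
apply: ae_filterS2 dx dy => t dx dy It.
apply: (is_derive_eq (is_deriveM (dx It) (dy It))).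
by rewrite /GRing.scale/=; ring.
Qed.

Lemma ac_derivN {R : realType} (I : set R) (x g : R -> R) :
  ac_deriv I x g -> ac_deriv I (fun t => - x t) (fun t => - g t).
Proof.
move=> xg; have := ac_derivM (ac_deriv_cst I (-1)) xg.
have -> : (fun t => -1 * x t) = (fun t => - x t).
  by apply/funext => t; rewrite mulN1r.
by apply: ac_deriv_eq => t _; rewrite mul0r add0r mulN1r.
Qed.

Lemma ac_deriv_expR {R : realType} (I : set R) (x g : R -> R) :
  ac_deriv I x g ->
  ac_deriv I (fun t => expR (x t)) (fun t => g t * expR (x t)).
Proof.
move=> [acx dx]; split.
  move=> c d cd cdI; have ax := acx _ _ cd cdI.
  have [M HM] := abs_continuous_bounded ax.
  apply: (abs_continuous_dominated (L := expR M) ax ax) => u v cu uv vd.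
  have le_exp (a b : R) : b <= M -> expR b - expR a <= expR M * `|b - a|.
    move=> bM; have -> : expR a = expR b * expR (a - b).
      by rewrite -expRD; congr expR; ring.
    have h1 := expR_ge1Dx (a - b); have h2 := ler_norm (b - a).
    have h3 : expR b <= expR M by rewrite ler_expR.
    have h4 := ler_wpM2l (expR_ge0 b) h1.
    have h5 := ler_wpM2l (expR_ge0 b) h2.
    have h6 := ler_wpM2r (normr_ge0 (b - a)) h3.
    lra.
  have xv : x v <= M by apply: (le_trans (ler_norm _)); apply: HM; lra.
  have xu : x u <= M by apply: (le_trans (ler_norm _)); apply: HM; lra.
  have h1 := le_exp (x v) (x u) xu; have h2 := le_exp (x u) (x v) xv.
  have h3 : 0 <= expR M * `|x v - x u| by rewrite mulr_ge0 ?expR_ge0.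
  by rewrite distrC in h1; rewrite ler_norml; apply/andP; split; lra.
apply: ae_filterS dx => t dx It.
by rewrite mulrC; exact: is_derive1_comp (is_derive_expR (x t)) (dx It).
Qed.

(** The lower bound m on compact subintervals makes inversion Lipschitz on the
    values of x. *)
Lemma ac_derivV {R : realType} (I : set R) (x g : R -> R) :
  (forall t, I t -> 0 < x t) ->
  (forall c d, c <= d -> `[c, d]%classic `<=` I -> exists2 m, 0 < m &
     forall t, c <= t <= d -> m <= x t) ->
  ac_deriv I x g ->
  ac_deriv I (fun t => (x t)^-1) (fun t => - g t * (x t)^-1 ^+ 2).
Proof.
move=> x0 xm [acx dx]; split.
  move=> c d cd cdI; have ax := acx _ _ cd cdI.
  have [m m0 Hm] := xm _ _ cd cdI.
  apply: (abs_continuous_dominated (L := m^-1 * m^-1) ax ax) => u v cu uv vd.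
  have mv : m <= x v by apply: Hm; lra.
  have mu : m <= x u by apply: Hm; lra.
  have xu0 := lt_le_trans m0 mu; have xv0 := lt_le_trans m0 mv.
  have -> : (x v)^-1 - (x u)^-1 = - (x v - x u) * ((x v)^-1 * (x u)^-1).
    by field; rewrite !gt_eqF.
  rewrite normrM normrN (gtr0_norm (_ : 0 < (x v)^-1 * (x u)^-1)); last first.
    by rewrite mulr_gt0 ?invr_gt0.
  have h : (x v)^-1 * (x u)^-1 <= m^-1 * m^-1.
    by apply: ler_pM; rewrite ?invr_ge0 ?(ltW xu0) ?(ltW xv0)//
      lef_pV2// posrE.
  have h1 := ler_wpM2l (normr_ge0 (x v - x u)) h.
  have h2 : 0 <= m^-1 * m^-1 * `|x v - x u|.
    by rewrite !mulr_ge0 ?invr_ge0 ?(ltW m0).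
  lra.
apply: ae_filterS dx => t dx It.
have xt0 : x t != 0 by rewrite gt_eqF// x0.
apply: (is_derive_eq (is_deriveV xt0 (dx It))).
by rewrite /GRing.scale/= exprVn; ring.
Qed.

Lemma ac_deriv_le {R : realType} (I : set R) (c d : R) (x g : R -> R) :
  ac_deriv I x g -> c <= d -> `[c, d]%classic `<=` I ->
  (forall t, c <= t <= d -> 0 <= g t) -> x c <= x d.
Proof.
move=> [acx dx] cd cdI g0.
apply: (@abs_continuous_ae_nondecreasing _ _ _ x g) => //.
- exact: acx.
- apply: ae_filterS dx => t dx /andP[ct td]; apply: dx; apply: cdI => /=.
  by rewrite in_itv/= !ltW.
- by move=> t /andP[ct td]; apply: g0; rewrite !ltW.
Qed.

(** Uniqueness for scalar linear equations with bounded coefficient: the square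
    of z, weighted by an exponential with rate 2 L, is monotone. *)
Lemma linear_ode_zero {R : realType} (I : set R) (c d L : R) (z g : R -> R) :
  ac_deriv I z (fun t => g t * z t) -> `[c, d]%classic `<=` I ->
  (forall t, c <= t <= d -> `|g t| <= L) ->
  forall s t, c <= s <= d -> c <= t <= d -> z s = 0 -> z t = 0.
Proof.
move=> dz cdI gL s t /andP[cs sd] /andP[ct td] zs0.
(* for k = - 2 L the weighted square is nonincreasing, for k = 2 L it is
   nondecreasing *)
have weighted k := ac_derivM (ac_derivM dz dz)
  (ac_deriv_expR (ac_derivM (ac_deriv_cst I k) (ac_deriv_id I))).
have le_sub u v : c <= u -> v <= d -> `[u, v]%classic `<=` I.
  move=> cu vd w /=; rewrite in_itv/= => /andP[uw wv]; apply: cdI => /=.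
  by rewrite in_itv/=; apply/andP; split; lra.
apply/eqP; rewrite -sqrf_eq0 eq_le sqr_ge0 andbT.
have [st|ts] := leP s t.
- have := ac_deriv_le (ac_derivN (weighted (- (2 * L)))) st (le_sub _ _ cs td).
  rewrite zs0 !mul0r oppr0 => H.
  have {}H : 0 <= - (z t * z t * expR (- (2 * L) * t)).
    apply: H => r /andP[sr rt].
    have /gL : c <= r <= d by lra.
    rewrite ler_norml => /andP[_ gr].
    rewrite (_ : - _ = 2 * (L - g r) * (z r) ^+ 2 * expR (- (2 * L) * r)).
      apply: mulr_ge0; last exact: expR_ge0.
      by apply: mulr_ge0; [lra|exact: sqr_ge0].
    by ring.
  by move: H; rewrite oppr_ge0 pmulr_lle0 ?expR_gt0.
- have := ac_deriv_le (weighted (2 * L)) (ltW ts) (le_sub _ _ ct sd).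
  rewrite zs0 !mul0r => H.
  have {}H : z t * z t * expR (2 * L * t) <= 0.
    apply: H => r /andP[sr rt].
    have /gL : c <= r <= d by lra.
    rewrite ler_norml => /andP[gr _].
    rewrite (_ : _ + _ = 2 * (L + g r) * (z r) ^+ 2 * expR (2 * L * r)).
      apply: mulr_ge0; last exact: expR_ge0.
      by apply: mulr_ge0; [lra|exact: sqr_ge0].
    by ring.
  by move: H; rewrite pmulr_lle0 ?expR_gt0.
Qed.

(** * Primitives of locally bounded measurable functions *)

Definition locally_bounded_mfun {R : realType} (f : R -> R) : Prop :=
  measurable_fun [set: R] f /\
  forall c d, exists M, forall t, c <= t <= d -> `|f t| <= M.

Lemma continuous_locally_bounded_mfun {R : realType} (f : R -> R) :
  continuous f -> locally_bounded_mfun f.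
Proof.
move=> cf; split; first exact: continuous_measurable_fun.
move=> c d; have [dc|cd] := ltP d c.
  by exists 0 => t /andP[ct td]; have := le_lt_trans (le_trans ct td) dc;
     rewrite ltxx.
have [|m _ Hm] := @EVT_max R (fun t => `|f t|) c d cd.
  by apply: continuous_subspaceT => t; apply: (@cvg_norm R R); exact: cf.
by exists (`|f m|) => t tcd; apply: Hm; rewrite in_itv.
Qed.

Lemma locally_bounded_mfunD {R : realType} (f g : R -> R) :
  locally_bounded_mfun f -> locally_bounded_mfun g ->
  locally_bounded_mfun (fun t => f t + g t).
Proof.
move=> [mf bf] [mg bg]; split; first exact: measurable_funD.
move=> c d; have [M HM] := bf c d; have [N HN] := bg c d.
exists (M + N) => t tcd; apply: (le_trans (ler_normD _ _)).
by apply: lerD; [exact: HM|exact: HN].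
Qed.

Lemma locally_bounded_mfunZ {R : realType} (k : R) (f : R -> R) :
  locally_bounded_mfun f -> locally_bounded_mfun (fun t => k * f t).
Proof.
move=> [mf bf]; split; first exact: measurable_funM.
move=> c d; have [M HM] := bf c d; exists (`|k| * M) => t tcd.
by rewrite normrM ler_wpM2l// HM.
Qed.

Lemma locally_bounded_mfun_integrable {R : realType} (f : R -> R) (c d : R) :
  locally_bounded_mfun f ->
  (@lebesgue_measure R).-integrable `[c, d]%classic (EFin \o f).
Proof.
move=> [mf bf]; apply: measurable_bounded_integrable => //.
- by rewrite /= lebesgue_measure_itv/=; case: ifPn => _; rewrite ?ltry//
    -EFinB ltry.
- exact: measurable_funTS.
- have [M HM] := bf c d; exists M; split; first exact: num_real.
  by move=> N MN t /=; rewrite in_itv/= => /HM/le_trans; apply; exact: ltW.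
Qed.

Lemma locally_bounded_mfun_locally_integrable {R : realType} (f : R -> R) :
  locally_bounded_mfun f -> locally_integrable [set: R] f.
Proof.
move=> bf; split; [exact: bf.1|exact: openT|move=> K _ cK].
have [M [_ HM]] := compact_bounded cK.
have KM : K `<=` `[- (M + 1), M + 1]%classic.
  move=> t Kt /=; rewrite in_itv/= -ler_norml.
  by have := HM (M + 1); rewrite ltrDl => /(_ ltr01 t Kt).
have iM := locally_bounded_mfun_integrable (- (M + 1)) (M + 1) bf.
suff /integrableP[] : (@lebesgue_measure R).-integrable K (EFin \o f) by [].
by apply: integrableS iM => //; exact: compact_measurable.
Qed.

Lemma oriented_integralE {R : realType} (f : R -> R) (m s t : R) :
  locally_bounded_mfun f -> m <= s -> m <= t ->
  oriented_integral f s t =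
    \int[@lebesgue_measure R]_(l in `[m, t]) f l -
    \int[@lebesgue_measure R]_(l in `[m, s]) f l.
Proof.
move=> bf ms mt; rewrite /oriented_integral.
have itvB u v : m <= u -> u <= v ->
    \int[@lebesgue_measure R]_(l in `[u, v]) f l =
    \int[@lebesgue_measure R]_(l in `[m, v]) f l -
    \int[@lebesgue_measure R]_(l in `[m, u]) f l.
  move=> mu uv; rewrite Rintegral_itvB ?bnd_simp//; last first.
    exact: locally_bounded_mfun_integrable.
  rewrite Rintegral_itv_obnd_cbnd//.
  apply: integrableS (locally_bounded_mfun_integrable u v bf) => //.
  by apply: subset_itvr; rewrite bnd_simp.
have [st|ts] := leP s t; first by rewrite itvB.
by rewrite (itvB t s)// ?opprB// ltW.
Qed.

Lemma oriented_integral_add {R : realType} (f : R -> R) (s t u : R) :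
  locally_bounded_mfun f ->
  oriented_integral f s u = oriented_integral f s t + oriented_integral f t u.
Proof.
move=> bf; pose m := Num.min s (Num.min t u).
have ms : m <= s by rewrite ge_min lexx.
have mt : m <= t by rewrite !ge_min lexx orbT.
have mu : m <= u by rewrite !ge_min lexx !orbT.
by rewrite !(oriented_integralE bf (m := m))//; ring.
Qed.

Lemma oriented_integral_same {R : realType} (f : R -> R) (s : R) :
  oriented_integral f s s = 0.
Proof. by rewrite /oriented_integral lexx set_itv1 Rintegral_set1. Qed.

Lemma oriented_integralC {R : realType} (f : R -> R) (s t : R) :
  locally_bounded_mfun f -> oriented_integral f t s = - oriented_integral f s t.
Proof.
move=> bf; apply/eqP; rewrite -addr_eq0 -oriented_integral_add//.
by rewrite oriented_integral_same.
Qed.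

(** Lebesgue's differentiation theorem gives the derivative; local boundedness
    makes the primitive locally Lipschitz. *)
Lemma ac_deriv_oriented_integral {R : realType} (f : R -> R) (s : R) :
  locally_bounded_mfun f -> ac_deriv [set: R] (oriented_integral f s) f.
Proof.
move=> bf; split.
  move=> c d cd _; have [M HM] := bf.2 c d.
  apply: (@abs_continuous_lipschitz _ _ _ M) => u v cu uv vd.
  rewrite (oriented_integral_add s u v bf) addrAC subrr add0r.
  rewrite /oriented_integral uv.
  have iuv := locally_bounded_mfun_integrable u v bf.
  apply: (le_trans (le_normr_Rintegral _ iuv)); first exact: measurable_itv.
  apply: (@le_trans _ _ (\int[@lebesgue_measure R]_(l in `[u, v]) M)).
    apply: le_Rintegral; first exact: measurable_itv.
    - exact: (integrable_norm iuv).
    - apply: (@locally_bounded_mfun_integrable _ (fun=> M)).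
      by apply: continuous_locally_bounded_mfun => t; exact: cvg_cst.
    - move=> l /=; rewrite in_itv/= => /andP[ul lv]; apply: HM; lra.
  rewrite Rintegral_cst; last exact: measurable_itv.
  rewrite /= lebesgue_measure_itv/= lte_fin; case: ifPn => [_//|].
  by rewrite -leNgt/= => vu; rewrite mulr0 (_ : v = u) ?subrr ?mulr0//; lra.
have FTC n : {ae @lebesgue_measure R, forall t : R, - n%:R < t ->
    is_derive t 1 (oriented_integral f s) (f t)}.
  pose m : R := Num.min s (- n%:R).
  have ms : m <= s by rewrite ge_min lexx.
  have int_m y : (@lebesgue_measure R).-integrable
      [set` Interval (BLeft m) (BRight y)] (EFin \o f).
    exact: locally_bounded_mfun_integrable.
  have := FTC1 int_m (locally_bounded_mfun_locally_integrable bf).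
  apply: ae_filterS => t Ht nt.
  have mt : m < t by rewrite gt_min nt orbT.
  have [] := Ht; first by rewrite /= lte_fin.
  set F := fun x => _ => dF F't.
  have FtF : is_derive t 1 F (f t).
    by split; [exact: dF|rewrite -derive1E; exact: F't].
  have := is_deriveB FtF (is_derive_cst (F s) t 1).
  rewrite subr0; apply: near_eq_is_derive.
  near=> u; rewrite (oriented_integralE bf ms)//.
  by near: u; apply: filterS (lt_nbhsr mt) => v; exact: ltW.
apply: ae_filterS (ae_foralln FTC) => t Ht _.
apply: (Ht (Num.Def.archi_bound `|- t|)).
have : 0 <= `|t| by []; rewrite -normrN => /archi_boundP.
by move=> /(le_lt_trans (ler_norm _)); rewrite ltrNl; apply.
Unshelve. all: by end_near. Qed.

(** A right-continuous function is the pointwise limit of the step functions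
    that read it at the next point of finer and finer grids. *)
Lemma right_continuous_measurable {R : realType} (f : R -> R) :
  right_continuous f -> measurable_fun [set: R] f.
Proof.
move=> rcf.
pose grid (n : nat) (k : int) : R := (k + 1)%:~R / n.+1%:R.
(* the next grid point is strictly to the right of t, as the right limit at t
   requires *)
pose h (n : nat) (t : R) := f (grid n (Num.floor (t * n.+1%:R))).
suff hf t : [set: R] t -> h ^~ t @ \oo --> f t.
  apply: measurable_fun_cvg hf => n _ Y mY; rewrite setTI.
  have -> : h n @^-1` Y = \bigcup_(k : int) (if `[< Y (f (grid n k)) >]
      then `[k%:~R / n.+1%:R, grid n k[%classic else set0).
    apply/seteqP; split => t /=.
      move=> Yt; exists (Num.floor (t * n.+1%:R)) => //.
      rewrite ifT; last exact/asboolP.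
      by rewrite /= in_itv/= ler_pdivrMr// ltr_pdivlMr// floor_itv.
    move=> [k _]; case: ifPn => // /asboolP Yk.
    rewrite /= in_itv/= ler_pdivrMr// ltr_pdivlMr// => kt.
    by rewrite /h (floor_def kt).
  apply: countable_bigcupT_measurable; first exact: countableP.
  by move=> k; case: ifPn.
move=> _; apply/cvgrPdist_lt => e e0.
have /cvgrPdist_lt/(_ _ e0) := rcf t.
rewrite near_withinE => /nbhs_ballP[d /= d0 Hd].
have := near_infty_natSinv_lt (PosNum d0); apply: filterS => n /= nd.
have /andP[h1 h2] := floor_itv (t * n.+1%:R).
have gt : t < grid n (Num.floor (t * n.+1%:R)) by rewrite ltr_pdivlMr.
apply: Hd => //; rewrite /ball/= distrC gtr0_norm ?subr_gt0//.
apply: le_lt_trans nd; rewrite lerBlDr ler_pdivrMr// mulrDl mulVf//.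
by rewrite intrD addrC lerD2l.
Qed.

Lemma bounded_fun_ex {R : realType} (f : R -> R) :
  bounded_fun f -> exists M, forall t, `|f t| <= M.
Proof.
move=> [M [_ HM]]; exists (M + 1) => t.
by apply: (HM (M + 1)) => //; rewrite ltrDl.
Qed.

Lemma BPUC_locally_bounded_mfun {R : realType} (q : R -> R) :
  BPUC q -> locally_bounded_mfun q.
Proof.
move=> [n [d [f [df]]]] /funext ->.
have {d df} bf i : locally_bounded_mfun (f i).
  have [_ [/bounded_fun_ex[M HM] rcf _]] := df i.
  by split; [exact: right_continuous_measurable|exists M].
elim: n => [|n IHn] in f bf *.
  have -> : (fun t => \sum_(i < 0) f i t) = fun=> 0.
    by apply/funext => t; rewrite big_ord0.
  by apply: continuous_locally_bounded_mfun => t; exact: cvg_cst.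
have -> : (fun t => \sum_(i < n.+1) f i t) =
    fun t => f ord0 t + \sum_(i < n) f (lift ord0 i) t.
  by apply/funext => t; rewrite big_ord_recl.
by apply: locally_bounded_mfunD => //; exact: (IHn (fun i => f (lift ord0 i))).
Qed.

(** * The Riccati flow in terms of one global solution *)

(** The solution with value 1 at s of the variational equation along b. *)
Definition growth {R : realType} (q b : R -> R) (s t : R) : R :=
  expR (oriented_integral (fun l => - 2 * b l + q l) s t).

(** The denominator in the explicit solution of the Bernoulli equation
    w' = (q - 2 b) w - w^2 with w(s) = y. *)
Definition denom {R : realType} (q b : R -> R) (s y t : R) : R :=
  1 + y * oriented_integral (growth q b s) s t.

Lemma solution_ac_deriv {R : realType} (q p x : R -> R) (I : set R) :
  solution_on q p I x ->
  ac_deriv I x (fun t => - x t ^+ 2 + q t * x t + p t).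
Proof. by case. Qed.

Lemma solution_continuous {R : realType} (q p b : R -> R) :
  solution_on q p [set: R] b -> continuous b.
Proof.
by move=> [_ _ acb _]; apply: abs_continuous_continuous => c d cd; exact: acb.
Qed.

Lemma coef_locally_bounded_mfun {R : realType} (q b : R -> R) :
  locally_bounded_mfun q -> continuous b ->
  locally_bounded_mfun (fun l => - 2 * b l + q l).
Proof.
move=> bq /continuous_locally_bounded_mfun cb.
by apply: locally_bounded_mfunD => //; exact: locally_bounded_mfunZ.
Qed.

Lemma growth_gt0 {R : realType} (q b : R -> R) (s t : R) : 0 < growth q b s t.
Proof. exact: expR_gt0. Qed.

Lemma growth_same {R : realType} (q b : R -> R) (s : R) : growth q b s s = 1.
Proof. by rewrite /growth oriented_integral_same expR0. Qed.

Lemma growthV {R : realType} (q b : R -> R) (s t : R) :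
  locally_bounded_mfun q -> continuous b ->
  growth q b t s = (growth q b s t)^-1.
Proof.
move=> bq cb; rewrite /growth oriented_integralC ?expRN//.
exact: coef_locally_bounded_mfun.
Qed.

Lemma ac_deriv_growth {R : realType} (q b : R -> R) (s : R) :
  locally_bounded_mfun q -> continuous b ->
  ac_deriv [set: R] (growth q b s)
    (fun t => (- 2 * b t + q t) * growth q b s t).
Proof.
move=> bq cb; apply: ac_deriv_expR; apply: ac_deriv_oriented_integral.
exact: coef_locally_bounded_mfun.
Qed.

Lemma ac_deriv_continuous {R : realType} (x g : R -> R) :
  ac_deriv [set: R] x g -> continuous x.
Proof.
by move=> [acx _]; apply: abs_continuous_continuous => c d cd; exact: acx.
Qed.

Lemma ac_deriv_denom {R : realType} (q b : R -> R) (s y : R) :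
  locally_bounded_mfun q -> continuous b ->
  ac_deriv [set: R] (denom q b s y) (fun t => y * growth q b s t).
Proof.
move=> bq cb.
have bG : locally_bounded_mfun (growth q b s).
  apply: continuous_locally_bounded_mfun.
  exact: ac_deriv_continuous (ac_deriv_growth s bq cb).
have := ac_derivD (ac_deriv_cst _ 1) (ac_derivM (ac_deriv_cst _ y)
  (ac_deriv_oriented_integral s bG)).
by apply: ac_deriv_eq => t _; rewrite mul0r !add0r.
Qed.

Lemma denom_same {R : realType} (q b : R -> R) (s y : R) :
  denom q b s y s = 1.
Proof. by rewrite /denom oriented_integral_same mulr0 addr0. Qed.

(** The denominator is monotone in t, with direction given by the sign of y. So
    its positivity set is an interval, and it is bounded away from 0 on compact
    subintervals. *)
Lemma denom_ge_min {R : realType} (q b : R -> R) (s y c d t : R) :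
  locally_bounded_mfun q -> continuous b -> c <= t <= d ->
  Num.min (denom q b s y c) (denom q b s y d) <= denom q b s y t.
Proof.
move=> bq cb /andP[ct td]; have dD := ac_deriv_denom s y bq cb.
rewrite ge_min; have [y0|y0] := leP 0 y; apply/orP; [left|right].
  apply: (ac_deriv_le dD ct) => // r _.
  by apply: mulr_ge0 => //; exact/ltW/growth_gt0.
rewrite -lerN2; apply: (ac_deriv_le (ac_derivN dD) td) => // r _.
by rewrite -mulNr; apply: mulr_ge0; [lra|exact/ltW/growth_gt0].
Qed.

(** The substitution y = b + w turns the equation into the Bernoulli equation
    w' = (q - 2 b) w - w^2, whose solution with value w(s) at s is
    w(s) growth / denom. The difference between the two sides of the claimed
    identity solves a homogeneous linear equation and vanishes at s. *)
Lemma solution_eq {R : realType} (q p b y : R -> R) (J : set R) (s t : R) :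
  locally_bounded_mfun q -> solution_on q p [set: R] b ->
  solution_on q p J y -> J s -> J t ->
  (y t - b t) * denom q b s (y s - b s) t = (y s - b s) * growth q b s t.
Proof.
move=> bq solb soly Js Jt; have cb := solution_continuous solb.
set y0 := y s - b s.
have restrict x g : ac_deriv [set: R] x g -> ac_deriv J x g.
  exact: ac_deriv_sub.
have dw := ac_derivD (solution_ac_deriv soly)
  (ac_derivN (restrict _ _ (solution_ac_deriv solb))).
have dz := ac_derivD (ac_derivM dw (restrict _ _ (ac_deriv_denom s y0 bq cb)))
  (ac_derivN (ac_derivM (ac_deriv_cst J y0)
    (restrict _ _ (ac_deriv_growth s bq cb)))).
(* z' = g z for z = (y - b) denom - y0 growth *)
pose g l := (- 2 * b l + q l) + (- 1 * y l + b l).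
have {}dz : ac_deriv J (fun l => (y l - b l) * denom q b s y0 l +
    - (y0 * growth q b s l)) (fun l => g l * ((y l - b l) * denom q b s y0 l +
    - (y0 * growth q b s l))).
  apply: ac_deriv_eq dz => l _; rewrite /g.
  move: (y l) (b l) (q l) (p l) (denom _ _ _ _ _) (growth _ _ _ _).
  by move: y0 => w0 y1 b1 q1 p1 D G; ring.
pose c := Num.min s t; pose d := Num.max s t.
have cdJ : `[c, d]%classic `<=` J.
  have [_ iJ _ _] := soly; rewrite /c /d => l /=; rewrite in_itv/=.
  by case: (leP s t) => _ ?; [apply: (iJ s t)|apply: (iJ t s)].
have cd : c <= d by rewrite /c /d; case: (leP s t) => // /ltW.
have [Ly HLy] : exists M, forall l, c <= l <= d -> `|y l| <= M.
  by apply: abs_continuous_bounded; have [_ _ acy _] := soly; exact: acy.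
have [Lb HLb] := (continuous_locally_bounded_mfun cb).2 c d.
have [Lc HLc] := (coef_locally_bounded_mfun bq cb).2 c d.
have gL l : c <= l <= d -> `|g l| <= Lc + (Ly + Lb).
  move=> lcd; apply: (le_trans (ler_normD _ _)); apply: lerD; first exact: HLc.
  apply: (le_trans (ler_normD _ _)); apply: lerD; last exact: HLb.
  by rewrite mulN1r normrN; exact: HLy.
have scd : c <= s <= d by rewrite /c /d ge_min le_max !lexx.
have tcd : c <= t <= d by rewrite /c /d ge_min le_max !lexx !orbT.
have := linear_ode_zero dz cdJ gL scd tcd.
rewrite denom_same growth_same !mulr1 subrr => /(_ erefl).
by move=> /eqP; rewrite subr_eq0 => /eqP.
Qed.

Definition riccati {R : realType} (q b : R -> R) (s x0 t : R) : R :=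
  b t + (x0 - b s) * growth q b s t / denom q b s (x0 - b s) t.

Definition riccati_dom {R : realType} (q b : R -> R) (s x0 : R) : set R :=
  [set t | 0 < denom q b s (x0 - b s) t].

Lemma riccati_solution {R : realType} (q p b : R -> R) (s x0 : R) :
  locally_bounded_mfun q -> solution_on q p [set: R] b ->
  solution_on q p (riccati_dom q b s x0) (riccati q b s x0).
Proof.
move=> bq solb; have cb := solution_continuous solb.
set y := x0 - b s; have dD := ac_deriv_denom s y bq cb.
have restrict x g :
    ac_deriv [set: R] x g -> ac_deriv (riccati_dom q b s x0) x g.
  exact: ac_deriv_sub.
have dV : ac_deriv (riccati_dom q b s x0) (fun t => (denom q b s y t)^-1)
    (fun t => - (y * growth q b s t) * (denom q b s y t)^-1 ^+ 2).
  apply: ac_derivV (restrict _ _ dD) => // c d cd cdI.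
  exists (Num.min (denom q b s y c) (denom q b s y d)).
    by rewrite lt_min; apply/andP; split; apply: cdI; rewrite /= in_itv/=
      lexx cd.
  by move=> t; exact: denom_ge_min.
have dx := ac_derivD (restrict _ _ (solution_ac_deriv solb)) (ac_derivM
  (ac_derivM (ac_deriv_cst _ y) (restrict _ _ (ac_deriv_growth s bq cb))) dV).
have {dx}[acx dx] : ac_deriv (riccati_dom q b s x0) (riccati q b s x0)
    (fun t => - riccati q b s x0 t ^+ 2 + q t * riccati q b s x0 t + p t).
  apply: ac_deriv_eq dx => t It; rewrite /riccati -/y.
  move: (gt_eqF It) => /=; rewrite -/y.
  move: (b t) (q t) (p t) (denom _ _ _ _ _) (growth _ _ _ _).
  by move=> b1 q1 p1 D G D0; field; rewrite D0.
split => //.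
  rewrite (_ : riccati_dom q b s x0 = denom q b s y @^-1` [set u | 0 < u]) //.
  by apply: open_comp; [move=> t _; exact: (ac_deriv_continuous dD)
    |exact: open_gt].
move=> c d Ic Id t ctd.
by apply: lt_le_trans (denom_ge_min s y bq cb ctd); rewrite lt_min Ic Id.
Qed.

Lemma riccati_dom_start {R : realType} (q b : R -> R) (s x0 : R) :
  riccati_dom q b s x0 s.
Proof. by rewrite /riccati_dom/= denom_same. Qed.

Lemma riccati_start {R : realType} (q b : R -> R) (s x0 : R) :
  riccati q b s x0 s = x0.
Proof.
by rewrite /riccati denom_same growth_same mulr1 divr1 addrC subrK.
Qed.

(** No solution can live beyond the interval where the denominator is
    positive: by the identity above the denominator cannot vanish along a
    solution that differs from b. *)
Lemma solution_sub_riccati_dom {R : realType} (q p b y : R -> R) (J : set R)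
    (s : R) :
  locally_bounded_mfun q -> solution_on q p [set: R] b ->
  solution_on q p J y -> J s -> J `<=` riccati_dom q b s (y s).
Proof.
move=> bq solb soly Js t Jt; have cb := solution_continuous solb.
rewrite /riccati_dom/=; set y0 := y s - b s.
have [->|y00] := eqVneq y0 0; first by rewrite /denom mul0r addr0.
have D0 l : J l -> denom q b s y0 l != 0.
  move=> Jl; apply/eqP => Dl; have := solution_eq bq solb soly Js Jl.
  rewrite -/y0 Dl mulr0 => /esym/eqP; rewrite mulf_eq0 (negbTE y00)/=.
  by rewrite gt_eqF// growth_gt0.
rewrite ltNge; apply/negP => Dt.
have cD := ac_deriv_continuous (ac_deriv_denom s y0 bq cb).
have Ds := denom_same q b s y0.
have [_ iJ _ _] := soly.
have [st|ts] := leP s t.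
- have [||l] := @IVT _ (denom q b s y0) s t 0 st.
  + exact: continuous_subspaceT.
  + by rewrite Ds ge_min le_max ler01 Dt orbT.
  rewrite in_itv/= => slt Dl; have := D0 l (iJ s t Js Jt l slt).
  by rewrite Dl eqxx.
- have [||l] := @IVT _ (denom q b s y0) t s 0 (ltW ts).
  + exact: continuous_subspaceT.
  + by rewrite Ds ge_min le_max ler01 Dt orbT.
  rewrite in_itv/= => slt Dl; have := D0 l (iJ t s Jt Js l slt).
  by rewrite Dl eqxx.
Qed.

Lemma solution_riccati {R : realType} (q p b y : R -> R) (J : set R) (s t : R) :
  locally_bounded_mfun q -> solution_on q p [set: R] b ->
  solution_on q p J y -> J s -> J t -> y t = riccati q b s (y s) t.
Proof.
move=> bq solb soly Js Jt.
have := solution_sub_riccati_dom bq solb soly Js Jt.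
rewrite /riccati_dom/= => D0.
rewrite /riccati -(solution_eq bq solb soly Js Jt) mulfK ?gt_eqF//.
by rewrite addrC subrK.
Qed.

(** The explicit solution is maximal because every solution through (s, x0) lives
    inside its domain; any other maximal solution agrees with it and, being
    maximal, cannot have a smaller domain. *)
Lemma flow_pairP {R : realType} (q p b : R -> R) (s x0 : R) :
  locally_bounded_mfun q -> solution_on q p [set: R] b ->
  flow_dom q p s x0 = riccati_dom q b s x0 /\
  forall t, riccati_dom q b s x0 t -> flow q p t s x0 = riccati q b s x0 t.
Proof.
move=> bq solb; have solx := riccati_solution s x0 bq solb.
have ex : [set Ix | maximal_solution q p s x0 Ix.1 Ix.2]
    (riccati_dom q b s x0, riccati q b s x0).
  split => //=; [exact: riccati_dom_start|exact: riccati_start|].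
  move=> J y soly IJ yx.
  have ys : y s = x0 by rewrite yx ?riccati_start//; exact: riccati_dom_start.
  rewrite -ys; apply: solution_sub_riccati_dom soly _ => //.
  exact/IJ/riccati_dom_start.
have := xgetPex (set0, fun=> 0) (ex_intro _ _ ex).
rewrite -/(flow_pair q p s x0) => -[solf Is fs fmax].
have sub := solution_sub_riccati_dom bq solb solf Is; rewrite fs in sub.
have eqf t : (flow_pair q p s x0).1 t ->
    (flow_pair q p s x0).2 t = riccati q b s x0 t.
  by move=> It; rewrite (solution_riccati bq solb solf Is It) fs.
have domE : flow_dom q p s x0 = riccati_dom q b s x0.
  apply/seteqP; split => //; apply: fmax solx sub _ => t It.
  by rewrite eqf.
by split => // t; rewrite -domE => /eqf.
Qed.

(** * Pairs of global solutions *)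

Lemma oriented_integral_ge {R : realType} (f : R -> R) (m s t : R) :
  locally_bounded_mfun f -> s <= t -> (forall l, s <= l <= t -> m <= f l) ->
  m * (t - s) <= oriented_integral f s t.
Proof.
move=> bf st mf.
have d := ac_derivD (ac_deriv_oriented_integral s bf)
  (ac_derivN (ac_derivM (ac_deriv_cst [set: R] m) (ac_deriv_id _))).
have := ac_deriv_le d st (@subsetT _ _).
rewrite oriented_integral_same => H.
have {}H : 0 + - (m * s) <= oriented_integral f s t + - (m * t).
  by apply: H => l /mf; lra.
lra.
Qed.

Lemma oriented_integral_le {R : realType} (f : R -> R) (m s t : R) :
  locally_bounded_mfun f -> s <= t -> (forall l, s <= l <= t -> f l <= m) ->
  oriented_integral f s t <= m * (t - s).
Proof.
move=> bf st mf.
have d := ac_derivD (ac_derivM (ac_deriv_cst [set: R] m) (ac_deriv_id _))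
  (ac_derivN (ac_deriv_oriented_integral s bf)).
have := ac_deriv_le d st (@subsetT _ _).
rewrite oriented_integral_same => H.
have {}H : m * s + - 0 <= m * t + - oriented_integral f s t.
  by apply: H => l /mf; lra.
lra.
Qed.

Lemma difference_locally_bounded_mfun {R : realType} (q p b c : R -> R) :
  solution_on q p [set: R] b -> solution_on q p [set: R] c ->
  locally_bounded_mfun (fun l => c l - b l).
Proof.
move=> /solution_continuous cb /solution_continuous cc.
apply: continuous_locally_bounded_mfun => l.
by apply: cvgB; [exact: cc|exact: cb].
Qed.

(** Along b the variational coefficient is q - 2 b, whereas c - b has
    logarithmic derivative q - b - c; the two differ by c - b itself. *)
Lemma growth_difference {R : realType} (q p b c : R -> R) (s t : R) :
  locally_bounded_mfun q -> solution_on q p [set: R] b ->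
  solution_on q p [set: R] c ->
  growth q b s t * (c s - b s) =
    (c t - b t) * expR (oriented_integral (fun l => c l - b l) s t).
Proof.
move=> bq solb solc; have cb := solution_continuous solb.
have cc := solution_continuous solc.
have bw := difference_locally_bounded_mfun solb solc.
pose w0 := c s - b s.
have dz := ac_derivD (ac_derivM (ac_derivD (solution_ac_deriv solc)
    (ac_derivN (solution_ac_deriv solb)))
    (ac_deriv_expR (ac_deriv_oriented_integral s bw)))
  (ac_derivN (ac_derivM (ac_deriv_cst _ w0) (ac_deriv_growth s bq cb))).
pose z l := (c l - b l) * expR (oriented_integral (fun l => c l - b l) s l) -
  w0 * growth q b s l.
have {}dz : ac_deriv [set: R] z (fun l => (- 2 * b l + q l) * z l).
  apply: ac_deriv_eq dz => l _; rewrite /z.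
  move: (c l) (b l) (q l) (p l) (growth _ _ _ _) (expR _) => *.
  by ring.
have [L HL] := (coef_locally_bounded_mfun bq cb).2 (Num.min s t) (Num.max s t).
have := linear_ode_zero dz (@subsetT _ _) HL (s := s) (t := t).
rewrite /z oriented_integral_same expR0 growth_same !ge_min !le_max !lexx.
rewrite !orbT !mulr1 subrr => /(_ isT isT erefl)/eqP.
by rewrite subr_eq0 => /eqP ->; rewrite mulrC.
Qed.

Lemma oriented_integralN {R : realType} (f : R -> R) (s t : R) :
  locally_bounded_mfun f ->
  oriented_integral (fun l => - f l) s t = - oriented_integral f s t.
Proof.
move=> bf; have RintN u v : \int[@lebesgue_measure R]_(l in `[u, v]) (- f l) =
    - \int[@lebesgue_measure R]_(l in `[u, v]) f l.
  rewrite -mulN1r -RintegralZl//; last exact: locally_bounded_mfun_integrable.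
  by apply: eq_Rintegral => l _; rewrite mulN1r.
by rewrite /oriented_integral !RintN; case: ifP.
Qed.

Lemma growth_difference_upper {R : realType} (q p b c : R -> R) (s t : R) :
  locally_bounded_mfun q -> solution_on q p [set: R] b ->
  solution_on q p [set: R] c ->
  growth q c s t * (c s - b s) =
    (c t - b t) * expR (- oriented_integral (fun l => c l - b l) s t).
Proof.
move=> bq solb solc; rewrite -oriented_integralN; last first.
  exact: difference_locally_bounded_mfun solb solc.
under [X in oriented_integral X]eq_fun do rewrite opprB.
apply: oppr_inj; rewrite -mulrN -mulNr !opprB.
exact: (growth_difference s t bq solc solb).
Qed.

Lemma solutions_ordered {R : realType} (q p b c : R -> R) (s t : R) :
  locally_bounded_mfun q -> solution_on q p [set: R] b ->
  solution_on q p [set: R] c -> b s < c s -> b t < c t.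
Proof.
move=> bq solb solc bc; rewrite -subr_gt0.
rewrite -(pmulr_lgt0 _ (expR_gt0 (oriented_integral (fun l => c l - b l) s t))).
rewrite -(growth_difference s t bq solb solc) mulr_gt0 ?growth_gt0//.
by rewrite subr_gt0.
Qed.

Lemma solutions_neq_ordered {R : realType} (q p b c : R -> R) :
  locally_bounded_mfun q -> solution_on q p [set: R] b ->
  solution_on q p [set: R] c -> b <> c ->
  (forall t, b t < c t) \/ (forall t, c t < b t).
Proof.
move=> bq solb solc bc.
have [s bcs] : exists s, b s != c s.
  apply: contrapT => H; apply: bc; apply/funext => t.
  by apply: contrapT => /eqP h; apply: H; exists t.
by case: (ltgtP (b s) (c s)) bcs => // h _; [left|right] => t;
  exact: (@solutions_ordered _ q p _ _ s).
Qed.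

Lemma exp_decay_le0 {R : realType} (x C beta : R) : 0 < beta ->
  (forall T, 0 <= T -> x <= C * expR (- beta * T)) -> x <= 0.
Proof.
move=> beta0 H; rewrite leNgt; apply/negP => x0.
have C0 : 0 < C.
  by have := H 0 (lexx _); rewrite mulr0 expR0 mulr1; exact: lt_le_trans.
have bx0 : 0 < beta * x by rewrite mulr_gt0.
(* at T = C / (beta x) the inequality exp z >= 1 + z already contradicts H *)
have T0 : 0 <= C / (beta * x) by rewrite divr_ge0 ?ltW.
have := H _ T0; rewrite mulNr expRN.
have -> : beta * (C / (beta * x)) = C / x by field; rewrite !gt_eqF.
rewrite ler_pdivlMr ?expR_gt0// leNgt => /negP; apply.
apply: lt_le_trans (ler_wpM2l (ltW x0) (expR_ge1Dx (C / x))).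
by rewrite mulrDr mulr1 mulrCA mulfV ?gt_eqF// mulr1 ltrDr.
Qed.

Lemma bounded_solutions_difference {R : realType} (q p b c : R -> R) :
  bounded_solution q p b -> bounded_solution q p c ->
  exists M, forall t, `|c t - b t| <= M.
Proof.
move=> [_ /bounded_fun_ex[M HM]] [_ /bounded_fun_ex[N HN]]; exists (N + M) => t.
by apply: (le_trans (ler_normB _ _)); exact: lerD.
Qed.

(** A uniform gap delta is itself the dichotomy exponent: the exponential factor
    in the identities for growth is at most exp(- delta |t - s|), and the ratio
    of the two differences is bounded. *)
Lemma separated_dichotomy {R : realType} (q p b c : R -> R) (delta : R) :
  locally_bounded_mfun q -> bounded_solution q p b -> bounded_solution q p c ->
  0 < delta -> (forall t, delta <= c t - b t) ->
  exists k, [/\ 1 <= k, attractive_bound q c k delta &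
                repulsive_bound q b k delta].
Proof.
move=> bq solb solc delta0 gap.
have [M HM] := bounded_solutions_difference solb solc.
have {}HM t : c t - b t <= M by apply: le_trans (ler_norm _) (HM t).
have bw := difference_locally_bounded_mfun solb.1 solc.1.
have bound s t (G E : R) : G * (c s - b s) = (c t - b t) * E -> 0 < E ->
    G <= M / delta * E.
  move=> GE E0; have ws := lt_le_trans delta0 (gap s).
  have -> : G = (c t - b t) * E / (c s - b s) by rewrite -GE mulfK// gt_eqF.
  rewrite mulrAC; apply: ler_wpM2r; first exact: ltW.
  apply: ler_pM; [|by rewrite invr_ge0 ltW|exact: HM|].
    by rewrite (le_trans _ (gap t))// ltW.
  by rewrite lef_pV2 ?posrE.
exists (M / delta); split.
- by rewrite ler_pdivlMr// mul1r (le_trans (gap 0)).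
- move=> s t st; rewrite -/(growth q c s t).
  have GE := growth_difference_upper s t bq solb.1 solc.1.
  apply: (le_trans (bound _ _ _ _ GE (expR_gt0 _))).
  rewrite ler_wpM2l//; first by rewrite divr_ge0 ?ltW// (lt_le_trans delta0)//
    (le_trans (gap 0)).
  rewrite ler_expR mulNr lerN2.
  exact: (oriented_integral_ge bw st (fun l _ => gap l)).
- move=> s t ts; rewrite -/(growth q b s t).
  have GE := growth_difference s t bq solb.1 solc.1.
  apply: (le_trans (bound _ _ _ _ GE (expR_gt0 _))).
  rewrite ler_wpM2l//; first by rewrite divr_ge0 ?ltW// (lt_le_trans delta0)//
    (le_trans (gap 0)).
  rewrite ler_expR (oriented_integralC _ _ bw).
  have := oriented_integral_ge bw ts (fun l _ => gap l).
  by rewrite -(opprB s t) mulrN lerN2.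
Qed.

(** If b were attractive, the difference c - b at time 0 would be at most
    k exp(- beta T) times its value at time -T, which is bounded. *)
Lemma lower_not_attractive {R : realType} (q p b c : R -> R) (k beta : R) :
  locally_bounded_mfun q -> bounded_solution q p b -> bounded_solution q p c ->
  (forall t, b t < c t) -> 1 <= k -> 0 < beta -> ~ attractive_bound q b k beta.
Proof.
move=> bq solb solc bc k1 beta0 attr.
have [M HM] := bounded_solutions_difference solb solc.
have bw := difference_locally_bounded_mfun solb.1 solc.1.
suff : c 0 - b 0 <= 0 by have := bc 0; lra.
apply: (@exp_decay_le0 _ _ (k * M) beta) => // T T0.
have GE := growth_difference (- T) 0 bq solb.1 solc.1.
have NT : - T <= 0 by lra.
have W0 : 0 <= oriented_integral (fun l => c l - b l) (- T) 0.
  have := oriented_integral_ge bw NT (m := 0).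
  by rewrite mul0r; apply => l _; have := bc l; lra.
have W1 : 1 <= expR (oriented_integral (fun l => c l - b l) (- T) 0).
  by rewrite -expR0 ler_expR.
apply: (@le_trans _ _ (growth q b (- T) 0 * (c (- T) - b (- T)))).
  by rewrite GE ler_peMr// subr_ge0 ltW.
rewrite mulrAC; apply: ler_pM.
- exact/ltW/growth_gt0.
- by rewrite subr_ge0 ltW.
- by have := attr _ _ NT; rewrite opprK add0r.
- by apply: le_trans (ler_norm _) (HM _).
Qed.

(** The mirror image in time: compare the difference at 0 with its value at a
    large time T. *)
Lemma upper_not_repulsive {R : realType} (q p b c : R -> R) (k beta : R) :
  locally_bounded_mfun q -> bounded_solution q p b -> bounded_solution q p c ->
  (forall t, b t < c t) -> 1 <= k -> 0 < beta -> ~ repulsive_bound q c k beta.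
Proof.
move=> bq solb solc bc k1 beta0 rep.
have [M HM] := bounded_solutions_difference solb solc.
have bw := difference_locally_bounded_mfun solb.1 solc.1.
suff : c 0 - b 0 <= 0 by have := bc 0; lra.
apply: (@exp_decay_le0 _ _ (k * M) beta) => // T T0.
have GE := growth_difference_upper T 0 bq solb.1 solc.1.
have W0 : 0 <= - oriented_integral (fun l => c l - b l) T 0.
  rewrite (oriented_integralC _ _ bw) opprK.
  have := oriented_integral_ge bw T0 (m := 0).
  by rewrite mul0r; apply => l _; have := bc l; lra.
have W1 : 1 <= expR (- oriented_integral (fun l => c l - b l) T 0).
  by rewrite -expR0 ler_expR.
apply: (@le_trans _ _ (growth q c T 0 * (c T - b T))).
  by rewrite GE ler_peMr// subr_ge0 ltW.
rewrite mulrAC; apply: ler_pM.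
- exact/ltW/growth_gt0.
- by rewrite subr_ge0 ltW.
- by have := rep _ _ T0; rewrite sub0r mulrN mulNr.
- by apply: le_trans (ler_norm _) (HM _).
Qed.

(** Growth from 0 to T and back from T to 0 multiply to 1, although both factors
    would decay exponentially in T. *)
Lemma attractive_repulsive_absurd {R : realType} (q b : R -> R)
    (k beta k' beta' : R) :
  locally_bounded_mfun q -> continuous b -> 1 <= k -> 0 < beta ->
  1 <= k' -> 0 < beta' ->
  attractive_bound q b k beta -> ~ repulsive_bound q b k' beta'.
Proof.
move=> bq cb k1 beta0 k1' beta0' attr rep.
suff : (1 : R) <= 0 by rewrite ler10.
apply: (@exp_decay_le0 _ _ (k * k') (beta + beta')); first exact: addr_gt0.
move=> T T0; have := attr _ _ T0; have := rep _ _ T0.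
rewrite -/(growth q b 0 T) -/(growth q b T 0) growthV// sub0r subr0 => h1 h2.
rewrite -(mulfV (_ : growth q b 0 T != 0)) ?gt_eqF ?growth_gt0//.
have -> : k * k' * expR (- (beta + beta') * T) =
    k * expR (- beta * T) * (k' * expR (beta' * - T)).
  by rewrite mulrACA -expRD; congr (_ * expR _); ring.
by apply: ler_pM => //; rewrite ?invr_ge0; exact/ltW/growth_gt0.
Qed.

(** Multiplying the identities for growth along b backwards and along c
    forwards shows that the integral W of c - b over [s, s + T] satisfies
    exp(-2 W) <= k k' exp(-(beta + beta') T), so that W >= 1 for the chosen T.
    On the other hand c - b can grow at most by the factor k exp(M T) within
    time T, so it cannot be small at s. *)
Lemma dichotomies_separated {R : realType} (q p b c : R -> R)
    (k beta k' beta' : R) :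
  locally_bounded_mfun q -> bounded_solution q p b -> bounded_solution q p c ->
  (forall t, b t < c t) ->
  1 <= k -> 0 < beta -> attractive_bound q c k beta ->
  1 <= k' -> 0 < beta' -> repulsive_bound q b k' beta' ->
  exists2 delta, 0 < delta & forall t, delta <= c t - b t.
Proof.
move=> bq solb solc bc k1 beta0 attr k1' beta0' rep.
have [M HM] := bounded_solutions_difference solb solc.
have {}HM t : c t - b t <= M by apply: le_trans (ler_norm _) (HM t).
have bw := difference_locally_bounded_mfun solb.1 solc.1.
have w_gt0 t : 0 < c t - b t by rewrite subr_gt0.
have kk1 : 1 <= k * k' by rewrite mulr_ege1.
have kk0 : 0 < k * k' by rewrite (lt_le_trans _ kk1).
have M0 : 0 <= M by apply: le_trans (HM 0); exact/ltW.
(* makes k k' exp(- (beta + beta') T) equal to exp(- 2) *)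
pose T := (ln (k * k') + 2) / (beta + beta').
have bb0 : 0 < beta + beta' by rewrite addr_gt0.
have T0 : 0 < T by rewrite divr_gt0// ltr_wpDl// ln_ge0.
pose D := k * expR (M * T) * T.
have k0 : 0 < k by exact: lt_le_trans k1.
have D0 : 0 < D by rewrite mulr_gt0// mulr_gt0// expR_gt0.
exists D^-1 => [|s]; first by rewrite invr_gt0.
pose W t := oriented_integral (fun l => c l - b l) s t.
have Gc t : growth q c s t * (c s - b s) = (c t - b t) * expR (- W t).
  exact: (growth_difference_upper s t bq solb.1 solc.1).
have W_le t : s <= t <= s + T -> W t <= M * T.
  move=> /andP[st tT].
  apply: le_trans (oriented_integral_le bw st (fun l _ => HM l)) _.
  by apply: ler_wpM2l => //; lra.
have w_le t : s <= t <= s + T -> c t - b t <= k * expR (M * T) * (c s - b s).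
  move=> tT; have -> : c t - b t = growth q c s t * (c s - b s) * expR (W t).
    by rewrite Gc -mulrA -expRD addNr expR0 mulr1.
  rewrite mulrAC; apply: ler_wpM2r; first exact: ltW.
  apply: ler_pM; [exact/ltW/growth_gt0|exact: expR_ge0| |].
    move: tT => /andP[st _]; apply: (le_trans (attr _ _ st)).
    rewrite -[leRHS]mulr1 ler_wpM2l ?(ltW k0)// -expR0 ler_expR.
    by rewrite mulNr oppr_le0 mulr_ge0 ?subr_ge0// ltW.
  by rewrite ler_expR W_le.
have sT : s <= s + T by rewrite lerDl ltW.
have W_ub : W (s + T) <= D * (c s - b s).
  have -> : D * (c s - b s) = k * expR (M * T) * (c s - b s) * (s + T - s).
    by rewrite /D; ring.
  exact: (oriented_integral_le bw sT w_le).
have W_lb : 1 <= W (s + T).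
  have Gb : growth q b (s + T) s * (c (s + T) - b (s + T)) =
      (c s - b s) * expR (- W (s + T)).
    by rewrite (growth_difference _ _ bq solb.1 solc.1) oriented_integralC.
  have GG : growth q b (s + T) s * growth q c s (s + T) =
      expR (- (2 * W (s + T))).
    have ww0 : (c s - b s) * (c (s + T) - b (s + T)) != 0.
      by rewrite mulf_neq0 ?gt_eqF.
    apply: (mulIf ww0); rewrite [X in _ * X]mulrC mulrACA Gb Gc mulrACA -expRD.
    by rewrite mulrC; congr (expR _ * _); ring.
  have : expR (- (2 * W (s + T))) <= expR (- 2).
    rewrite -GG.
    apply: (@le_trans _ _ (k' * expR (beta' * (s - (s + T))) *
        (k * expR (- beta * (s + T - s))))).
      by apply: ler_pM; [exact/ltW/growth_gt0|exact/ltW/growth_gt0|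
        exact: rep|exact: attr].
    rewrite mulrACA -expRD -(lnK (_ : k' * k \is Num.pos)); last first.
      by rewrite posrE mulrC.
    rewrite -expRD ler_expR.
    have : (beta + beta') * T = ln (k' * k) + 2.
      by rewrite /T [k' * k]mulrC [LHS]mulrC divfK ?gt_eqF.
    lra.
  by rewrite ler_expR; lra.
rewrite -[leLHS]mulr1 ler_pdivrMl//.
exact: le_trans W_ub.
Qed.

(** * Convergence to the extremal solutions *)

Lemma denom_ge1 {R : realType} (q b : R -> R) (s y t : R) :
  locally_bounded_mfun q -> continuous b -> 0 <= y * (t - s) ->
  1 <= denom q b s y t.
Proof.
move=> bq cb yts.
have bG : locally_bounded_mfun (growth q b s).
  apply: continuous_locally_bounded_mfun.
  exact: ac_deriv_continuous (ac_deriv_growth s bq cb).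
rewrite /denom lerDl.
have G0 u v : u <= v -> 0 <= oriented_integral (growth q b s) u v.
  move=> uv; have := oriented_integral_ge bG uv (m := 0).
  by rewrite mul0r; apply => l _; exact/ltW/growth_gt0.
case: (ltgtP s t) yts => [st|ts|->].
- by rewrite pmulr_lge0 ?subr_gt0// => y0; rewrite mulr_ge0// G0// ltW.
- rewrite nmulr_lge0 ?subr_lt0// => y0.
  by rewrite oriented_integralC// mulr_le0// oppr_le0 G0// ltW.
- by rewrite oriented_integral_same mulr0.
Qed.

(** The denominator is affine in the initial deviation y and is positive for
    the deviation of any other global solution c; hence it stays away from 0 for
    deviations in between which keep the distance eps from that of c. *)
Lemma denom_ge_between {R : realType} (q p b c : R -> R) (s t y M eps : R) :
  locally_bounded_mfun q -> solution_on q p [set: R] b ->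
  solution_on q p [set: R] c -> 0 < eps ->
  0 <= y * (c s - b s) -> `|y| <= `|c s - b s| - eps -> `|c s - b s| <= M ->
  eps / M <= denom q b s y t.
Proof.
move=> bq solb solc eps0.
have /(_ t I) := solution_sub_riccati_dom (s := s) bq solb solc I.
rewrite /riccati_dom/= /denom; set J := oriented_integral _ _ _.
move: (c s - b s) => w D0 yw yle wM.
have w0 : 0 < `|w| by have := normr_ge0 y; lra.
have wn0 : w != 0 by rewrite -normr_gt0.
(* denom(y) = (1 - th) + th denom(w), and denom(w) > 0 *)
pose th := y / w.
have th0 : 0 <= th.
  rewrite /th (_ : y / w = y * w / w ^+ 2); last by field.
  by rewrite divr_ge0// sqr_ge0.
have -> : y = th * w by rewrite /th divfK.
have th1 : th <= 1 - eps / M.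
  rewrite -(ger0_norm th0) normf_div ler_pdivrMr//.
  apply: (le_trans yle); rewrite mulrBl mul1r lerD2l lerN2 mulrAC.
  by rewrite ler_pdivrMr ?(lt_le_trans w0)// ler_wpM2l// ltW.
have : 0 <= th * (1 + w * J) by rewrite mulr_ge0// ltW.
lra.
Qed.

Lemma flow_difference_le {R : realType} (q p b : R -> R) (s t x0 m E : R) :
  locally_bounded_mfun q -> solution_on q p [set: R] b ->
  0 < m -> m <= denom q b s (x0 - b s) t -> growth q b s t <= E ->
  flow_dom q p s x0 t /\ `|b t - flow q p t s x0| <= m^-1 * E * `|b s - x0|.
Proof.
move=> bq solb m0 mD GE.
have D0 := lt_le_trans m0 mD.
have [-> /(_ t D0) ->] := flow_pairP s x0 bq solb; split => //.
rewrite /riccati opprD addrA subrr sub0r normrN normf_div normrM (distrC (b s)).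
rewrite (gtr0_norm D0) (gtr0_norm (growth_gt0 _ _ _ _)).
rewrite [leRHS]mulrC [m^-1 * E]mulrC mulrA.
apply: ler_pM; rewrite ?mulr_ge0 ?invr_ge0 ?(ltW D0) ?(ltW (growth_gt0 _ _ _ _))//.
  by rewrite ler_wpM2l.
by rewrite lef_pV2 ?posrE.
Qed.

(** When the initial deviation has the sign of t - s, the quadratic term only
    reduces it below the solution of the variational equation. *)
Lemma flow_approach_outside {R : realType} (q p b : R -> R) (s t x0 E : R) :
  locally_bounded_mfun q -> solution_on q p [set: R] b ->
  0 <= (x0 - b s) * (t - s) -> growth q b s t <= E ->
  flow_dom q p s x0 t /\ `|b t - flow q p t s x0| <= E * `|b s - x0|.
Proof.
move=> bq solb sgn GE; have cb := solution_continuous solb.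
have := flow_difference_le bq solb ltr01 (denom_ge1 bq cb sgn) GE.
by rewrite invr1 mul1r.
Qed.

(** A deviation towards the other solution c that keeps the distance eps from it
    exceeds the linear estimate by at most the factor M / eps. The constant
    k (1 + M / eps) covers both directions; E' >= E leaves room for the smaller
    exponent of the theorem. *)
Lemma flow_approach {R : realType} (q p b c : R -> R) (s t x0 M eps k E E' : R) :
  locally_bounded_mfun q -> solution_on q p [set: R] b ->
  solution_on q p [set: R] c -> (forall t, `|c t - b t| <= M) ->
  0 < eps -> 0 <= k ->
  0 <= (x0 - b s) * (t - s) \/
    0 <= (x0 - b s) * (c s - b s) /\ `|x0 - b s| <= `|c s - b s| - eps ->
  growth q b s t <= k * E -> E <= E' ->
  flow_dom q p s x0 t /\
  `|b t - flow q p t s x0| <= k * (1 + M / eps) * E' * `|b s - x0|.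
Proof.
move=> bq solb solc HM eps0 k0 side GE EE'.
have M0 : 0 <= M by exact: le_trans (HM 0).
have Me0 : 0 <= M / eps by rewrite divr_ge0// ltW.
have kE0 : 0 <= k * E by exact/ltW/(lt_le_trans (growth_gt0 _ _ _ _) GE).
have kEE' : k * E <= k * E' by exact: ler_wpM2l.
have kE'0 := le_trans kE0 kEE'.
have le_out N : N <= 1 + M / eps ->
    N * (k * E) * `|b s - x0| <= k * (1 + M / eps) * E' * `|b s - x0|.
  move=> N1; apply: ler_wpM2r => //.
  rewrite [leRHS](_ : _ = (1 + M / eps) * (k * E')); last by ring.
  apply: (le_trans (ler_wpM2r kE0 N1)); apply: ler_wpM2l => //.
  by rewrite addr_ge0.
case: side => [sgn|[sgn le_eps]].
  have [dom le_x] := flow_approach_outside bq solb sgn GE; split => //.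
  by apply: le_trans (le_x) _; rewrite -[k * E]mul1r le_out// lerDl.
have M_gt0 : 0 < M.
  by apply: lt_le_trans (HM s); have := normr_ge0 (x0 - b s); lra.
have eM0 : 0 < eps / M by rewrite divr_gt0.
have eD := denom_ge_between t bq solb solc eps0 sgn le_eps (HM s).
have [dom le_x] := flow_difference_le bq solb eM0 eD GE; split => //.
by apply: le_trans (le_x) _; rewrite invf_div le_out// lerDr.
Qed.

(** * Extremal solutions and hyperbolic solutions *)

Lemma bounded_solution_between {R : realType} (q p r a x : R -> R) :
  locally_bounded_mfun q -> extremal_bounded_solutions q p r a ->
  bounded_solution q p x -> forall s, r s <= x s <= a s.
Proof.
move=> bq [_ _ _ extr] solx s; apply/extr.
have [domE flowE] := flow_pairP s (x s) bq solx.1.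
have domT : riccati_dom q x s (x s) = [set: R].
  by apply/seteqP; split => // t _; rewrite /riccati_dom/= subrr /denom mul0r
    addr0.
have -> : (fun t => flow q p t s (x s)) = x.
  apply/funext => t; rewrite flowE ?domT//.
  by rewrite /riccati subrr mul0r mul0r addr0.
by rewrite domE domT.
Qed.

Lemma uniformly_separatedP {R : realType} (x1 x2 : R -> R) :
  uniformly_separated x1 x2 <->
  exists2 delta, 0 < delta & forall t, delta <= x2 t - x1 t.
Proof.
split=> [[le12 inf0]|[delta delta0 H]].
  exists (inf (range (fun t => x2 t - x1 t))) => // t.
  by apply: ge_inf; [exists 0 => _ [u _ <-]; rewrite subr_ge0|exists t].
split=> [t|]; first by have := H t; lra.
apply: lt_le_trans delta0 _; apply: lb_le_inf; first by exists (x2 0 - x1 0), 0.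
by move=> _ [t _ <-].
Qed.

(** Of two ordered bounded solutions the lower one cannot be attractive and the
    upper one cannot be repulsive, so a dichotomy decides the type. *)
Lemma ordered_dichotomy {R : realType} (q p b c : R -> R) (k beta k' beta' : R) :
  locally_bounded_mfun q -> bounded_solution q p b -> bounded_solution q p c ->
  (forall t, b t < c t) ->
  dichotomy_pair q b k beta -> dichotomy_pair q c k' beta' ->
  repulsive_bound q b k beta /\ attractive_bound q c k' beta'.
Proof.
move=> bq solb solc bc [k1 beta0 db] [k1' beta0' dc]; split.
  case: db => // attr.
  by have := lower_not_attractive bq solb solc bc k1 beta0 attr.
case: dc => // rep.
by have := upper_not_repulsive bq solb solc bc k1' beta0' rep.
Qed.

Lemma separated_hyperbolic {R : realType} (q p b c : R -> R) :
  locally_bounded_mfun q -> bounded_solution q p b -> bounded_solution q p c ->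
  uniformly_separated b c ->
  [/\ hyperbolic q p c, hyperbolic q p b, attractive q c & repulsive q b].
Proof.
move=> bq solb solc /uniformly_separatedP[delta delta0 gap].
have [k [k1 attr rep]] := separated_dichotomy bq solb solc delta0 gap.
have hc : attractive q c by exists k, delta.
have hb : repulsive q b by exists k, delta.
split=> //; split=> //; exists k, delta; split=> //.
  by left; exact: attr.
by right; exact: rep.
Qed.

Lemma hyperbolic_separated {R : realType} (q p b c : R -> R) :
  locally_bounded_mfun q -> hyperbolic q p b -> hyperbolic q p c ->
  (forall t, b t < c t) -> uniformly_separated b c.
Proof.
move=> bq [solb [k [beta db]]] [solc [k' [beta' dc]]] bc.
have [rep attr] := ordered_dichotomy bq solb solc bc db dc.
have [[k1 beta0 _] [k1' beta0' _]] := (db, dc).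
apply/uniformly_separatedP.
exact: (dichotomies_separated bq solb solc bc k1' beta0' attr k1 beta0 rep).
Qed.

(** A third hyperbolic solution would lie strictly between r and a, hence be
    repulsive because of a and attractive because of r. *)
Lemma hyperbolic_extremal {R : realType} (q p r a b : R -> R) :
  locally_bounded_mfun q -> extremal_bounded_solutions q p r a ->
  hyperbolic q p a -> hyperbolic q p r -> hyperbolic q p b -> b = a \/ b = r.
Proof.
move=> bq har [sola [ka [Ba da]]] [solr [kr [Br dr]]] [solb [k [B db]]].
have btw := bounded_solution_between bq har solb.
have [->|/eqP ba] := eqVneq b a; first by left.
have [->|/eqP br] := eqVneq b r; first by right.
exfalso.
have [ba_lt|/(_ 0)] := solutions_neq_ordered bq solb.1 sola.1 ba; last first.
  by have /andP[_] := btw 0; lra.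
have [/(_ 0)|rb_lt] := solutions_neq_ordered bq solb.1 solr.1 br.
  by have /andP[+ _] := btw 0; lra.
have [rep _] := ordered_dichotomy bq solb sola ba_lt db da.
have [_ attr] := ordered_dichotomy bq solr solb rb_lt dr db.
have [k1 B0 _] := db; have cb := solution_continuous solb.1.
exact: (attractive_repulsive_absurd bq cb k1 B0 k1 B0 attr rep).
Qed.

(** * Separation and hyperbolicity *)

Theorem theorem2p9 (R : realType) (q p : R -> R) (hq : BPUC q) (hp : BPUC p)
    (hbdd : exists b : R -> R, bounded_solution q p b)
    (a r : R -> R) (har : extremal_bounded_solutions q p r a) :
  (uniformly_separated r a <->
     [/\ hyperbolic q p a, hyperbolic q p r, attractive q a & repulsive q r]) /\
  ([/\ hyperbolic q p a, hyperbolic q p r, attractive q a & repulsive q r] <->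
     exists b1 b2 : R -> R,
       [/\ hyperbolic q p b1, hyperbolic q p b2 & b1 <> b2]) /\
  (uniformly_separated r a ->
    [/\ forall ka beta_a : R, dichotomy_pair q a ka beta_a ->
          (forall bbeta_a : R, 0 < bbeta_a < beta_a ->
           forall eps : R, 0 < eps ->
           exists2 kae : R, 1 <= kae &
             forall s t x0 : R, r s + eps <= x0 -> s <= t ->
               flow_dom q p s x0 t /\
               `|a t - flow q p t s x0| <=
                 kae * expR (- bbeta_a * (t - s)) * `|a s - x0|) /\
          (forall s t x0 : R, a s <= x0 -> s <= t ->
             flow_dom q p s x0 t /\
             `|a t - flow q p t s x0| <=
               ka * expR (- beta_a * (t - s)) * `|a s - x0|),
        forall kr beta_r : R, dichotomy_pair q r kr beta_r ->
          (forall bbeta_r : R, 0 < bbeta_r < beta_r ->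
           forall eps : R, 0 < eps ->
           exists2 kre : R, 1 <= kre &
             forall s t x0 : R, x0 <= a s - eps -> t <= s ->
               flow_dom q p s x0 t /\
               `|r t - flow q p t s x0| <=
                 kre * expR (bbeta_r * (t - s)) * `|r s - x0|) /\
          (forall s t x0 : R, x0 <= r s -> t <= s ->
             flow_dom q p s x0 t /\
             `|r t - flow q p t s x0| <=
               kr * expR (beta_r * (t - s)) * `|r s - x0|),
        forall b : R -> R, hyperbolic q p b -> b = a \/ b = r &
        forall x1 x2 : R -> R,
          bounded_solution q p x1 -> bounded_solution q p x2 ->
          uniformly_separated x1 x2 -> x1 = r /\ x2 = a]).
Proof.
have bq := BPUC_locally_bounded_mfun hq.
have [solr sola _ _] := har.
have btw := bounded_solution_between bq har.
have [M HM] := bounded_solutions_difference solr sola.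
have HM' t : `|r t - a t| <= M by rewrite distrC.
have ca := solution_continuous sola.1.
have a_to_b := separated_hyperbolic bq solr sola.
have b_to_c : [/\ hyperbolic q p a, hyperbolic q p r, attractive q a & repulsive q r]
    -> exists b1 b2 : R -> R,
      [/\ hyperbolic q p b1, hyperbolic q p b2 & b1 <> b2].
  move=> [ha hr [ka [Ba [ka1 Ba0 atta]]] [kr [Br [kr1 Br0 repr]]]].
  exists a, r; split => // ar; rewrite -ar in repr.
  exact: (attractive_repulsive_absurd bq ca ka1 Ba0 kr1 Br0 atta repr).
have c_to_a : (exists b1 b2 : R -> R,
    [/\ hyperbolic q p b1, hyperbolic q p b2 & b1 <> b2]) ->
    uniformly_separated r a.
  have widen b c : hyperbolic q p b -> hyperbolic q p c ->
      (forall t, b t < c t) -> uniformly_separated r a.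
    move=> hb hc /(hyperbolic_separated bq hb hc)/uniformly_separatedP.
    move=> [delta delta0 gap]; apply/uniformly_separatedP; exists delta => // t.
    have /andP[rb _] := btw _ hb.1 t; have /andP[_ ca_t] := btw _ hc.1 t.
    by have := gap t; lra.
  move=> [b1 [b2 [h1 h2 b12]]].
  by have [] := solutions_neq_ordered bq h1.1.1 h2.1.1 b12; exact: widen.
split; first by split => // /b_to_c/c_to_a.
split; first by split => // /c_to_a/a_to_b.
move=> sep; have [ha hr _ _] := a_to_b sep.
have ra_lt t : r t < a t.
  have /uniformly_separatedP[delta delta0 gap] := sep.
  by have := gap t; lra.
split.
- move=> ka Ba da.
  have [_ [kr' [Br' dr']]] := hr.
  have [_ atta] := ordered_dichotomy bq solr sola ra_lt dr' da.
  have [ka1 Ba0 _] := da.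
  split=> [Bb /andP[Bb0 BbB] eps eps0|s t x0 asx0 st].
    have ka0 : 0 <= ka by lra.
    exists (ka * (1 + M / eps)).
      rewrite mulr_ege1// lerDl divr_ge0 ?(ltW eps0)//.
      exact: le_trans (HM 0).
    move=> s t x0 rx0 st.
    apply: (flow_approach bq sola.1 solr.1 HM' eps0 ka0 _ (atta s t st)).
      have [ax0|x0a] := leP (a s) x0; [left|right].
        by rewrite mulr_ge0 ?subr_ge0.
      have ras := ra_lt s.
      rewrite !ltr0_norm; [|lra..].
      by split; [rewrite mulr_le0; lra|lra].
    rewrite ler_expR ler_wpM2r ?subr_ge0//; lra.
  apply: (flow_approach_outside bq sola.1 _ (atta s t st)).
  by rewrite mulr_ge0 ?subr_ge0.
- move=> kr Br dr.
  have [_ [ka' [Ba' da']]] := ha.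
  have [repr _] := ordered_dichotomy bq solr sola ra_lt dr da'.
  have [kr1 Br0 _] := dr.
  split=> [Bb /andP[Bb0 BbB] eps eps0|s t x0 x0r ts].
    have kr0 : 0 <= kr by lra.
    exists (kr * (1 + M / eps)).
      rewrite mulr_ege1// lerDl divr_ge0 ?(ltW eps0)//.
      exact: le_trans (HM 0).
    move=> s t x0 x0a ts.
    apply: (flow_approach bq solr.1 sola.1 HM eps0 kr0 _ (repr s t ts)).
      have [x0r|rx0] := leP x0 (r s); [left|right].
        by rewrite mulr_le0 ?subr_le0.
      have ras := ra_lt s.
      rewrite !gtr0_norm; [|lra..].
      by split; [rewrite mulr_ge0; lra|lra].
    rewrite ler_expR ler_wnM2r ?subr_le0//; lra.
  apply: (flow_approach_outside bq solr.1 _ (repr s t ts)).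
  by rewrite mulr_le0 ?subr_le0.
- by move=> b; exact: hyperbolic_extremal.
- move=> x1 x2 sol1 sol2 sep12.
  have [h2 h1 _ _] := separated_hyperbolic bq sol1 sol2 sep12.
  have /uniformly_separatedP[delta delta0 gap] := sep12.
  have x12 : x1 0 < x2 0 by have := gap 0; lra.
  have x1r : x1 = r.
    have [x1a|//] := hyperbolic_extremal bq har ha hr h1.
    by have /andP[_] := btw _ sol2 0; rewrite -x1a leNgt x12.
  split => //; have [//|x2r] := hyperbolic_extremal bq har ha hr h2.
  by move: x12; rewrite x1r x2r ltxx.
Qed.
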